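(* Let $n \ge 4$, let $V$ be an $n$-dimensional real vector space with a volume element, and let $V^*$ be its dual space with the dual volume element. Then for every symmetric convex body $K \subset V$ and any ellipsoid $B \subset V$, $$\frac{(\operatorname{Vol} K)(\operatorname{Vol} K^\circ)}{(\operatorname{Vol} B)(\operatorname{Vol} B^\circ)} \ge (\log_2 n)^{-n}.$$
   Context: $V$ is a finite-dimensional vector space over $\mathbb{R}$ with a volume element, and $V^*$ is its dual vector space with the dual volume element (so if $V=\mathbb{R}^n$ with Lebesgue measure, $V^*$ is identified with $\mathbb{R}^n$ with Lebesgue measure via the standard dot product). A convex body is a compact convex set with nonempty interior. A convex set is symmetric if it is invariant under $x \mapsto -x$. For a symmetric convex body $K \subset V$, its dual (polar) is $K^\circ = \{y \in V^* \mid y(K) \subset [-1,1]\}$. An ellipsoid in $V$ is a set of the form $\{x \in V \mid \langle x,x\rangle \le 1\}$ for some positive-definite inner product $\langle\cdot,\cdot\rangle$ on $V$ (in particular it is centered at the origin). The product $(\operatorname{Vol} B)(\operatorname{Vol} B^\circ)$ does not depend on the choice of the ellipsoid $B \subset V$; it equals $b_n^2$, where $b_n$ is the volume of the Euclidean unit ball in $\mathbb{R}^n$. *)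

(* Defs.v *)
From HB Require Import structures.
From mathcomp Require Import all_boot all_order all_algebra.
From mathcomp Require Import sesquilinear.
From mathcomp Require Import all_classical all_reals all_analysis.

Set Implicit Arguments.
Unset Strict Implicit.
Unset Printing Implicit Defensive.

Import Order.TTheory GRing.Theory Num.Theory.
Import numFieldNormedType.Exports.

Local Open Scope classical_set_scope.
Local Open Scope ring_scope.

Lemma product_sigma_finite d1 d2 (T1 : measurableType d1)
    (T2 : measurableType d2) (R : realType)
    (m1 : {sigma_finite_measure set T1 -> \bar R})
    (m2 : {sigma_finite_measure set T2 -> \bar R}) :
  sigma_finite setT (m1 \x m2)%E.
Proof.
have /sigma_finiteP[F [TF ndF Foo]] := sigma_finiteT m1.
have /sigma_finiteP[G [TG ndG Goo]] := sigma_finiteT m2.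
exists (fun n => F n `*` G n).
  rewrite -setXTT TF TG predeqE => -[x y]; split.
    move=> [/= [n _ Fnx] [k _ Gky]]; exists (maxn n k) => //; split.
    - by move: x Fnx; exact/subsetPset/ndF/leq_maxl.
    - by move: y Gky; exact/subsetPset/ndG/leq_maxr.
  by move=> [n _ []/= ? ?]; split; exists n.
move=> k; have [? ?] := Foo k; have [? ?] := Goo k.
split; first exact: measurableX.
by rewrite product_measure1E// lte_mul_pinfty// ge0_fin_numE.
Qed.

(* n-dimensional Lebesgue measure, on n.-tuple R with its product sigma-algebra.
   It is the iterated product measure, transported along (x, t) |-> x :: t. *)

Definition cons_tup (T : Type) n (p : T * n.-tuple T) : n.+1.-tuple T :=
  [tuple of p.1 :: p.2].

Section cons_measure.
Context (R : realType) (n : nat).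
Local Notation Rn := (n.-tuple (measurableTypeR R)).
Local Notation Rn1 := (n.+1.-tuple (measurableTypeR R)).
Variable mu : {sigma_finite_measure set Rn -> \bar R}.

Definition cons_measure : set Rn1 -> \bar R :=
  pushforward (@lebesgue_measure R \x mu)%E
    (@cons_tup (measurableTypeR R) n).

Lemma measurable_cons_tup :
  measurable_fun [set: (measurableTypeR R * Rn)%type] (@cons_tup (measurableTypeR R) n).
Proof.
exact: (measurable_cons measurable_fst measurable_snd).
Qed.

Let m : {measure set Rn1 -> \bar R} :=
  measure_function_pushforward__canonical__measure_function_Measure
    (@lebesgue_measure R \x mu)%E measurable_cons_tup.

Let cons_measure0 : cons_measure set0 = 0%E.
Proof. exact: (measure0 m). Qed.

Let cons_measure_ge0 A : (0 <= cons_measure A)%E.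
Proof. exact: (measure_ge0 m). Qed.

Let cons_measure_sigma_additive : semi_sigma_additive cons_measure.
Proof. exact: (@measure_semi_sigma_additive _ _ _ m). Qed.

HB.instance Definition _ := isMeasure.Build _ _ _ cons_measure
  cons_measure0 cons_measure_ge0 cons_measure_sigma_additive.

Let cons_measure_sigma_finite : sigma_finite setT cons_measure.
Proof.
have [F FT Ffin] := product_sigma_finite (@lebesgue_measure R) mu.
pose g (t : Rn1) : (measurableTypeR R * Rn)%type := (thead t, [tuple of behead t]).
have gK : cancel (@cons_tup (measurableTypeR R) n) g.
  by move=> [x t]; rewrite /g /cons_tup /= theadE; congr (_, _); apply: val_inj.
have mg : measurable_fun [set: Rn1] g.
  apply/measurable_fun_pairP; split; first exact: measurable_tnth.
  exact: measurable_behead.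
exists (fun k => g @^-1` F k).
  by rewrite -preimage_bigcup -FT preimage_setT.
move=> k; have [mF Foo] := Ffin k; split.
  by rewrite -[X in measurable X]setTI; exact: mg.
rewrite /cons_measure /pushforward -comp_preimage.
rewrite (_ : g \o _ = id) ?preimage_id//.
by apply/funext => p; exact: gK.
Qed.

HB.instance Definition _ := Measure_isSigmaFinite.Build _ _ _ cons_measure
  cons_measure_sigma_finite.

End cons_measure.

Fixpoint lebesgue_tuple (R : realType) (n : nat) :
    {sigma_finite_measure set (n.-tuple (measurableTypeR R)) -> \bar R} :=
  match n with
  | 0 => \d_([tuple of [::]] : 0.-tuple (measurableTypeR R))
  | n'.+1 => cons_measure (lebesgue_tuple R n')
  end.

Lemma lebesgue_tuple_box (R : realType) (n : nat)
    (A : 'I_n -> set (measurableTypeR R)) :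
  (forall i, measurable (A i)) ->
  lebesgue_tuple R n [set t | forall i, A i (tnth t i)] =
  (\prod_(i < n) @lebesgue_measure R (A i))%E.
Proof.
elim: n A => [|n IH] A mA.
  by rewrite big_ord0 /= diracE mem_set//= => -[].
rewrite big_ord_recl /= /cons_measure /pushforward.
have mB : measurable [set t : n.-tuple (measurableTypeR R) |
    forall i, A (lift ord0 i) (tnth t i)].
  rewrite [X in measurable X](_ : _ = \bigcap_(i in [set: 'I_n])
      ((fun t => tnth t i) @^-1` A (lift ord0 i))).
    apply: fin_bigcap_measurable => // i _.
    by rewrite -[X in measurable X]setTI; exact: measurable_tnth.
  by apply/seteqP; split=> [t Ht i _|t Ht i]; [exact: Ht|exact: (Ht i I)].
rewrite -IH// -product_measure1E//.
congr product_measure1; apply/seteqP; split=> -[x t] /=.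
  move=> H; split; first exact: (H ord0).
  by move=> i; have := H (lift ord0 i); rewrite tnthS; congr (A _ _);
    rewrite /tnth; apply: set_nth_default; rewrite size_tuple.
move=> [Hx Ht] i; case: (unliftP ord0 i) => [j ->|->] //.
by rewrite tnthS; have := Ht j.
Qed.

(* A volume element on an n-dimensional space V is a nonzero alternating
   n-linear form w; only `|w| matters for volumes. *)

Record volume_form (R : realType) (V : vectType R) (n : nat)
    (w : ('I_n -> V) -> R) : Prop := {
  volume_form_linear : forall (v : 'I_n -> V) (i : 'I_n) (a : R) (x y : V),
    w (dfwith v i (a *: x + y)) =
    a * w (dfwith v i x) + w (dfwith v i y) ;
  volume_form_alternating : forall (v : 'I_n -> V) (i j : 'I_n),
    i != j -> v i = v j -> w v = 0 ;
  volume_form_neq0 : exists v : 'I_n -> V, w v != 0 }.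

(* Taking n as a parameter, to be used with n = \dim {:V}, lets V and its dual
   share the index type 'I_n: the dimension of 'Hom(V, R^o) as a vectType is not
   convertible to that of V. *)
Definition std_basis (R : realType) (V : vectType R) (n : nat) (i : 'I_n) : V :=
  (vbasis {:V})`_i.

(* The parallelepiped spanned by a basis e has volume `|w e|, so A has volume
   `|w e| times the Lebesgue measure of its set of coordinates in e; by the change
   of variables formula this does not depend on e. *)
Definition vol (R : realType) (V : vectType R) (n : nat)
    (w : ('I_n -> V) -> R) (A : set V) : \bar R :=
  (`|w (@std_basis R V n)|%:E *
   lebesgue_tuple R n
     [set t | A (\sum_(i < n) tnth t i *: std_basis V i)%R])%E.

(* The dual form is characterised by dual_form w f * w v = \det (f_i (v_j)) for
   all f and v, so dual bases span parallelepipeds of inverse volumes. It is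
   written here with v the basis used by vol. *)
Definition dual_form (R : realType) (V : vectType R) (n : nat)
    (w : ('I_n -> V) -> R) (f : 'I_n -> 'Hom(V, R^o)) : R :=
  \det (\matrix_(i < n, j < n) (f i (std_basis V j) : R)) / w (@std_basis R V n).

(* A finite-dimensional real vector space carries the topology for which linear
   coordinates are homeomorphisms onto R^n. *)
Definition vect_topology (R : realType) (V : vectType R) :=
  initial_topology
    (fun x : V => \row_(i < \dim {:V}) coord (vbasis {:V}) i x).

Definition convex_body (R : realType) (V : vectType R) (K : set V) : Prop :=
  [/\ compact (K : set (vect_topology V)),
      convex_set (K : set (convex_lmodType V)) &
      interior (K : set (vect_topology V)) !=set0].

Definition symmetric_set (R : realType) (V : vectType R) (K : set V) : Prop :=
  -%R @` K = K.

Definition polar (R : realType) (V : vectType R) (K : set V) :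
    set 'Hom(V, R^o) :=
  [set y | y @` K `<=` `[-1, 1]].

Definition ellipsoid (R : realType) (V : vectType R) (B : set V) : Prop :=
  exists f : {dot V for (@idfun R)}, B = [set x | f x x <= 1].

(* Main.v *)
Require Import Defs.
From mathcomp Require Import all_boot all_order all_algebra.
From mathcomp Require Import ring lra.
From mathcomp Require Import perm sesquilinear.
From mathcomp Require Import all_classical all_reals all_analysis measurable_realfun.

(* For a norm p on R^n with unit ball of volume vball p, the integral of
   exp (- p) is a constant times vball p.  Substituting z = x + y in the double
   integral of exp (- p x - q y) and bounding the inner integral from below by
   translation to a near-minimizer of p x + q (z - x) gives
     vball p * vball q >= 2 ^- n * vball (infconv p q) * vball (max p q),
   where infconv p q is the gauge of the convex hull of the two unit balls.  If
   p and q are dual norms, then so are infconv p q and max p q, and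
   infconv p q <= |.|.  So if p <= |.| and q <= r |.|, then replacing the pair by
   (sqrt r p, q / sqrt r) and then by its infconv and max replaces r by sqrt r, at
   the cost of a factor 2 ^- n.  Iterating until r <= 4, where the bound
   r ^- n is good enough, the total loss is (2 log2 r) ^ n.  John's theorem
   provides coordinates in which r = sqrt n. *)

Set Implicit Arguments.
Unset Strict Implicit.
Unset Printing Implicit Defensive.

Import Order.TTheory GRing.Theory Num.Theory.
Import numFieldNormedType.Exports.

Local Open Scope classical_set_scope.
Local Open Scope ring_scope.

(** * The Hahn-Banach theorem in R^n *)

(** The translation step rests on p (x + x0) + q (z - x0 - x) <= (p x0 + q (z - x0)) + (p x + q x),
    whose last bracket is at most 2 max (p x) (q x): this doubling is the origin of the factor 2 ^-
    n. The infimum is only approached, so the estimate is proved up to a factor r < 1. The hull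
    contains the Euclidean ball because the intersection of two mutually polar bodies lies in it:
    dot x x <= p x * q x <= 1. Balancing the pair by sqrt r beforehand is what makes the max at most
    sqrt r times the Euclidean norm. The shape (2 log2 r) ^- n is exactly preserved by a step:
    passing to sqrt r halves log2 r, which pays for 2 ^- n. At r = sqrt n it equals (log2 n) ^- n,
    and n >= 4 gives r >= 2, where the base bound r <= 2 log2 r starts to hold. Lebesgue measure is
    only given as an iterated product on tuples, so its behaviour under linear maps is derived from
    translation invariance, by uniqueness of Haar measure. *)

Section inf_fun.
Context (R : realType) (T : Type).
Implicit Types (f : T -> R) (m : R).

(** [inf] takes a default value on sets that are empty or unbounded below, so the lemmas carry a
    lower bound [m] and, where needed, a point [x0]. *)
Definition inf_fun f : R := inf (range f).

Lemma inf_fun_le f m x : (forall y, m <= f y) -> inf_fun f <= f x.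
Proof.
move=> fm; apply: ge_inf; last by exists x.
by exists m => _ [y _ <-].
Qed.

Lemma le_inf_fun f m (x0 : T) : (forall y, m <= f y) -> m <= inf_fun f.
Proof.
move=> fm; apply: lb_le_inf; first by exists (f x0), x0.
by move=> _ [y _ <-].
Qed.

Lemma inf_fun_adherent f m (x0 : T) e : (forall y, m <= f y) -> 0 < e ->
  exists x, f x < inf_fun f + e.
Proof.
move=> fm e0; have [|_ [x _ <-] lt_x] := @inf_adherent R (range f) e e0.
  by split; [exists (f x0), x0 | exists m => _ [y _ <-]].
by exists x.
Qed.

End inf_fun.

Section hahn_banach.
Context (R : realType) (n : nat).
Implicit Types (p : 'rV[R]_n -> R) (x y z u v : 'rV[R]_n).

Definition dot x y : R := (x *m y^T) 0 0.

Lemma dotE x y : dot x y = \sum_i x 0 i * y 0 i.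
Proof. by rewrite /dot mxE; apply: eq_bigr => i _; rewrite mxE. Qed.

Lemma dotC x y : dot x y = dot y x.
Proof. by rewrite !dotE; apply: eq_bigr => i _; rewrite mulrC. Qed.

Lemma dotDl x y z : dot (x + y) z = dot x z + dot y z.
Proof. by rewrite /dot mulmxDl mxE. Qed.

Lemma dotZl a x y : dot (a *: x) y = a * dot x y.
Proof. by rewrite /dot -scalemxAl mxE. Qed.

Lemma dot0l y : dot 0 y = 0.
Proof. by rewrite /dot mul0mx mxE. Qed.

Lemma dotDr x y z : dot x (y + z) = dot x y + dot x z.
Proof. by rewrite dotC dotDl dotC [dot z x]dotC. Qed.

Lemma dotZr a x y : dot x (a *: y) = a * dot x y.
Proof. by rewrite dotC dotZl dotC. Qed.

Lemma dotNl x y : dot (- x) y = - dot x y.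
Proof. by rewrite -scaleN1r dotZl mulN1r. Qed.

Lemma dotNr x y : dot x (- y) = - dot x y.
Proof. by rewrite dotC dotNl dotC. Qed.

Lemma dot_mulmxl (A : 'M[R]_n) x y : dot (x *m A) y = dot x (y *m A^T).
Proof. by rewrite /dot trmx_mul trmxK mulmxA. Qed.

Lemma dot_ge0 x : 0 <= dot x x.
Proof. by rewrite dotE; apply: sumr_ge0 => i _; rewrite -expr2 sqr_ge0. Qed.

Lemma dot_eq0 x : dot x x = 0 -> x = 0.
Proof.
rewrite dotE => /eqP; rewrite psumr_eq0 => [|i _]; last by rewrite -expr2 sqr_ge0.
move=> /allP x0; apply/rowP => i; have := x0 i; rewrite mem_index_enum.
by rewrite mxE -expr2 sqrf_eq0 => /(_ isT) /eqP.
Qed.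

Definition sublinear p :=
  (forall x y, p (x + y) <= p x + p y) /\
  (forall a x, 0 <= a -> p (a *: x) = a * p x).

Lemma sublinear0 p : sublinear p -> p 0 = 0.
Proof. by move=> [_ /(_ 0 0 (lexx _))]; rewrite scale0r mul0r. Qed.

Lemma sublinear_oppr_ge0 p x : sublinear p -> 0 <= p x + p (- x).
Proof. by move=> sp; rewrite -(sublinear0 sp) -(subrr x); apply sp.1. Qed.

(* One step of Hahn-Banach: the infimum of p (x + t v) - t p v over t >= 0 is
   sublinear, below p, and linear along v. *)
Lemma sublinear_step p v : sublinear p ->
  exists q, [/\ sublinear q, forall x, q x <= p x & q (- v) <= - p v].
Proof.
move=> [pD pZ]; have sp : sublinear p by [].
(* The absolute value turns the infimum over t >= 0 into one over the whole type [R]. *)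
pose f x (t : R) := p (x + `|t| *: v) - `|t| * p v.
have fm x t : - p (- x) <= f x t.
  rewrite /f lerNl opprB lerBlDr -pZ // [leRHS]addrC.
  apply: le_trans (pD _ _); rewrite (_ : x + _ - x = `|t| *: v) // addrC addKr //.
have qle x t : inf_fun (f x) <= f x t by apply: inf_fun_le (fm x).
exists (fun x => inf_fun (f x)); split; first split.
- move=> x y; apply/ler_addgt0Pr => e e0.
  have e20 : 0 < e / 2 by rewrite divr_gt0.
  have [s fs] := inf_fun_adherent 0 (fm x) e20.
  have [t ft] := inf_fun_adherent 0 (fm y) e20.
  apply: (@le_trans _ _ (f x s + f y t)); last by move: fs ft; lra.
  apply: le_trans (qle (x + y) (`|s| + `|t|)) _; rewrite /f ger0_norm ?addr_ge0 //.
  have := pD (x + `|s| *: v) (y + `|t| *: v).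
  rewrite addrACA -scalerDl; move: (p (x + y + _)) => P; nra.
- move=> a x; rewrite le_eqVlt => /predU1P[<-|a0].
    rewrite scale0r mul0r; apply/eqP; rewrite eq_le; apply/andP; split.
      apply: le_trans (qle 0 0) _.
      by rewrite /f normr0 scale0r addr0 mul0r subr0 (sublinear0 sp).
    by apply: (le_inf_fun 0) => t; rewrite /f add0r pZ // subrr.
  have fZ t : f (a *: x) (a * t) = a * f x t.
    by rewrite /f normrM gtr0_norm // -scalerA -scalerDr pZ ?ltW // -mulrA -mulrBr.
  apply/eqP; rewrite eq_le; apply/andP; split.
    rewrite -ler_pdivrMl //; apply: (le_inf_fun 0) => t.
    by rewrite ler_pdivrMl // -fZ qle.
  apply: (le_inf_fun 0) => t; rewrite -[t](mulVKf (lt0r_neq0 a0)) fZ.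
  by rewrite ler_pM2l // qle.
- by move=> x; apply: le_trans (qle x 0) _; rewrite /f normr0 scale0r addr0 mul0r subr0.
- apply: le_trans (qle _ 1) _.
  by rewrite /f normr1 scale1r mul1r addNr (sublinear0 sp) sub0r.
Qed.

(** The equation [q v + q (- v) = 0] expresses linearity along [v]. It survives later steps: the sum
    can only decrease, and it is never negative for a sublinear function. *)
Lemma sublinear_steps p (s : seq 'rV[R]_n) : sublinear p ->
  exists q, [/\ sublinear q, forall x, q x <= p x &
    {in s, forall v, q v + q (- v) = 0}].
Proof.
move=> sp; elim: s => [|v s [q [sq qp qs]]]; first by exists p.
have [r [sr rq rv]] := sublinear_step v sq.
exists r; split => // [x|w]; first exact: le_trans (rq x) (qp x).
rewrite inE => /predU1P[->|ws]; apply/eqP; rewrite eq_le sublinear_oppr_ge0 // andbT.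
  by have := rq v; lra.
by rewrite -(qs _ ws) lerD.
Qed.

(** A step along [z] fixes the value at [z], and one step along each basis vector makes the function
    odd on the axes. Subadditivity then gives [q x <= dot u x], and the same at [- x] forces
    equality. *)
Theorem hahn_banach p z : sublinear p ->
  exists u, (forall x, dot u x <= p x) /\ dot u z = p z.
Proof.
move=> sp; have [q0 [sq0 q0p q0z]] := sublinear_step z sp.
have [q [sq qq0 qe]] := sublinear_steps (codom (fun i => delta_mx 0 i : 'rV[R]_n)) sq0.
pose u : 'rV[R]_n := \row_i q (delta_mx 0 i).
have qe' i : q (- delta_mx 0 i) = - q (delta_mx 0 i).
  have /qe : delta_mx 0 i \in codom (fun i => delta_mx 0 i : 'rV[R]_n) by rewrite codom_f.
  by lra.
have qZ a i : q (a *: delta_mx 0 i) = a * u 0 i.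
  rewrite mxE; case: (leP 0 a) => a0; first by rewrite sq.2.
  rewrite -[a]opprK scaleNr -scalerN sq.2 ?oppr_ge0 ?ltW // qe'; ring.
have qle x : q x <= dot u x.
  rewrite [x in q x]row_sum_delta dotE.
  elim/big_rec2 : _ => [|i y1 y2 _ le12]; first by rewrite sublinear0.
  by apply: le_trans (sq.1 _ _) _; rewrite qZ mulrC lerD2l.
have qdot x : dot u x = q x.
  apply/eqP; rewrite eq_le qle andbT.
  have := qle (- x); have := sublinear_oppr_ge0 x sq; rewrite dotNr; lra.
exists u; split => [x|]; first by rewrite qdot (le_trans (qq0 x)).
apply/eqP; rewrite eq_le qdot (le_trans (qq0 z)) //=.
have := qdot (- z); have := qq0 (- z); have := qdot z; rewrite dotNr; lra.
Qed.

End hahn_banach.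

(** * Dual pairs of seminorms *)

Section seminorms.
Context (R : realType) (n : nat).
Implicit Types (p q : 'rV[R]_n -> R) (x y z u v : 'rV[R]_n).

Definition enorm x : R := Num.sqrt (dot x x).

Lemma enorm_ge0 x : 0 <= enorm x. Proof. exact: sqrtr_ge0. Qed.

Lemma sqr_enorm x : enorm x ^+ 2 = dot x x.
Proof. by rewrite sqr_sqrtr // dot_ge0. Qed.

Lemma enorm_eq0 x : enorm x = 0 -> x = 0.
Proof. by move=> x0; apply: dot_eq0; rewrite -sqr_enorm x0 expr0n. Qed.

Lemma dot_le_enorm x y : dot x y <= enorm x * enorm y.
Proof.
have [/enorm_eq0 ->|x0] := eqVneq (enorm x) 0.
  by rewrite dot0l mulr_ge0 ?enorm_ge0.
have [/enorm_eq0 ->|y0] := eqVneq (enorm y) 0.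
  by rewrite dotC dot0l mulr_ge0 ?enorm_ge0.
have xy0 : 0 < enorm x * enorm y by rewrite mulr_gt0 // lt0r ?x0 ?y0 enorm_ge0.
rewrite -(ler_pM2l xy0) -subr_ge0 -(pmulr_rge0 _ (ltr0Sn R 1)).
apply: le_trans (dot_ge0 (enorm y *: x - enorm x *: y)) _.
rewrite !(dotDl, dotDr, dotNl, dotNr, dotZl, dotZr) -!sqr_enorm (dotC y x).
by rewrite le_eqVlt; apply/orP; left; apply/eqP; ring.
Qed.

(** Definiteness enters, where it matters, through a bound [enorm x <= c * p x], which says that the
    unit ball of [p] is bounded. *)
Definition seminorm p :=
  (forall x y, p (x + y) <= p x + p y) /\
  (forall a x, p (a *: x) = `|a| * p x).

Lemma seminorm_sublinear p : seminorm p -> sublinear p.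
Proof. by move=> [pD pZ]; split=> // a x a0; rewrite pZ ger0_norm. Qed.

Lemma seminorm0 p : seminorm p -> p 0 = 0.
Proof. by move=> /seminorm_sublinear /sublinear0. Qed.

Lemma seminormN p x : seminorm p -> p (- x) = p x.
Proof. by move=> [_ pZ]; rewrite -scaleN1r pZ normrN1 mul1r. Qed.

Lemma seminorm_ge0 p x : seminorm p -> 0 <= p x.
Proof.
move=> sp; have := sublinear_oppr_ge0 x (seminorm_sublinear sp).
by rewrite seminormN // -mulr2n pmulrn_lge0.
Qed.

Lemma seminormB p x y : seminorm p -> p (x - y) = p (y - x).
Proof. by move=> sp; rewrite -seminormN // opprB. Qed.

Lemma seminorm_enorm : seminorm enorm.
Proof.
split=> [x y|a x].
  rewrite -(ler_pXn2r (ltn0Sn 1)) ?nnegrE ?addr_ge0 ?enorm_ge0 //.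
  rewrite sqr_enorm sqrrD !sqr_enorm dotDl !dotDr (dotC y x).
  by have := dot_le_enorm x y; lra.
by rewrite /enorm dotZl dotZr mulrA -expr2 sqrtrM ?sqr_ge0 // sqrtr_sqr.
Qed.

Lemma seminormZ p a : seminorm p -> 0 <= a -> seminorm (fun x => a * p x).
Proof.
move=> [pD pZ] a0; split=> [x y|b x]; first by rewrite -mulrDr ler_wpM2l.
by rewrite pZ mulrCA.
Qed.

Lemma seminorm_mulmx p (A : 'M[R]_n) : seminorm p -> seminorm (fun x => p (x *m A)).
Proof. by move=> [pD pZ]; split=> [x y|a x]; rewrite ?mulmxDl ?pD // -scalemxAl pZ. Qed.

Definition max_fun p q x := Num.max (p x) (q x).

Lemma seminorm_max p q : seminorm p -> seminorm q -> seminorm (max_fun p q).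
Proof.
move=> [pD pZ] [qD qZ]; split=> [x y|a x].
  rewrite /max_fun ge_max; apply/andP; split.
    by rewrite (le_trans (pD x y)) // lerD // le_max lexx.
  by rewrite (le_trans (qD x y)) // lerD // le_max lexx ?orbT.
by rewrite /max_fun pZ qZ maxr_pMr.
Qed.

Definition infconv p q z : R := inf_fun (fun x => p x + q (z - x)).

Section infconv.
Variables (p q : 'rV[R]_n -> R) (sp : seminorm p) (sq : seminorm q).

Let pq_ge0 z x : 0 <= p x + q (z - x).
Proof. by rewrite addr_ge0 ?seminorm_ge0. Qed.

Lemma infconv_le z x : infconv p q z <= p x + q (z - x).
Proof. exact: inf_fun_le (pq_ge0 z). Qed.

Lemma infconv_adherent z e : 0 < e ->
  exists x, p x + q (z - x) < infconv p q z + e.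
Proof. by move=> e0; exact: (inf_fun_adherent 0 (pq_ge0 z) e0). Qed.

Lemma infconv_lel z : infconv p q z <= p z.
Proof. by have := infconv_le z z; rewrite subrr seminorm0 ?addr0. Qed.

Lemma infconv_ler z : infconv p q z <= q z.
Proof. by have := infconv_le z 0; rewrite subr0 seminorm0 ?add0r. Qed.

Lemma seminorm_infconv : seminorm (infconv p q).
Proof.
split=> [x y|a x].
  apply/ler_addgt0Pr => e e0.
  have e20 : 0 < e / 2 by rewrite divr_gt0.
  have [s xs] := infconv_adherent x e20; have [t yt] := infconv_adherent y e20.
  apply: le_trans (infconv_le (x + y) (s + t)) _.
  have := sp.1 s t; have := sq.1 (x - s) (y - t).
  by rewrite addrACA -opprD; lra.
have [->|a0] := eqVneq a 0.
  rewrite scale0r normr0 mul0r; apply/eqP; rewrite eq_le.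
  by rewrite (le_trans (infconv_lel 0)) ?(le_inf_fun 0 (pq_ge0 0)) ?seminorm0.
have na0 : 0 < `|a| by rewrite normr_gt0.
have pqZ y : p (a *: y) + q (a *: x - a *: y) = `|a| * (p y + q (x - y)).
  by rewrite -scalerBr sp.2 sq.2 mulrDr.
apply/eqP; rewrite eq_le; apply/andP; split.
  rewrite -ler_pdivrMl //; apply: (le_inf_fun 0) => y.
  by rewrite ler_pdivrMl // -pqZ infconv_le.
apply: (le_inf_fun 0) => y; rewrite -[y](scalerKV a0) pqZ.
by rewrite ler_pM2l // infconv_le.
Qed.

End infconv.

(* [p] and [q] are the gauges of two mutually polar bodies. *)
Record dual_pair p q : Prop := DualPair {
  dual_pair_dot : forall x y, dot x y <= p x * q y;
  dual_pair_r : forall u, (forall x, dot u x <= p x) -> q u <= 1;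
  dual_pair_l : forall u, (forall x, dot u x <= q x) -> p u <= 1 }.

Lemma dual_pairZ p q a : 0 < a -> seminorm p -> seminorm q -> dual_pair p q ->
  dual_pair (fun x => a * p x) (fun x => a^-1 * q x).
Proof.
move=> a0 [_ pZ] [_ qZ] [dpq dr dl]; split=> [x y|u ux|u ux].
- by rewrite mulrACA divff ?mul1r // gt_eqF.
- rewrite -[a^-1]gtr0_norm ?invr_gt0 // -qZ dr // => x.
  by rewrite dotZl ler_pdivrMl.
- rewrite -[X in X * _]gtr0_norm // -pZ dl // => x.
  by rewrite dotZl -ler_pdivlMl.
Qed.

(** A functional [u] supporting [infconv p q] at [z] lies below both [p] and [q]. The first gives
    [q u <= 1] by duality, the second [dot u u <= q u], so [u] has Euclidean norm at most 1. *)
Lemma infconv_le_enorm p q z : seminorm p -> seminorm q -> dual_pair p q ->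
  infconv p q z <= enorm z.
Proof.
move=> sp sq [dpq dr _]; have sQ := seminorm_infconv sp sq.
have [u [uQ <-]] := hahn_banach z (seminorm_sublinear sQ).
have up x : dot u x <= p x by rewrite (le_trans (uQ x)) ?infconv_lel.
have uq x : dot u x <= q x by rewrite (le_trans (uQ x)) ?infconv_ler.
suff u1 : enorm u <= 1.
  by apply: le_trans (dot_le_enorm u z) _; rewrite ler_piMl ?enorm_ge0.
rewrite -(ler_pXn2r (ltn0Sn 1)) ?nnegrE ?enorm_ge0 // expr1n sqr_enorm.
exact: le_trans (uq u) (dr u up).
Qed.

(** Polarity exchanges the hull of a union with an intersection of polars. As it also swaps the two
    given bodies, their hull and their intersection are polar to each other. *)
Lemma dual_pair_step p q : seminorm p -> seminorm q -> dual_pair p q ->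
  dual_pair (infconv p q) (max_fun p q).
Proof.
move=> sp sq [dpq dr dl]; split=> [x y|u uQ|u uP].
- apply/ler_addgt0Pr => e e0.
  (* Adding 1 keeps the denominator positive when the max vanishes at [y]. *)
  have e'0 : 0 < e / (max_fun p q y + 1).
    by rewrite divr_gt0 // ltr_wpDl // seminorm_ge0 //; exact: seminorm_max.
  have [z lez] := infconv_adherent sp sq x e'0.
  have M0 : 0 <= max_fun p q y by rewrite seminorm_ge0 //; exact: seminorm_max.
  have : dot x y <= (p z + q (x - z)) * max_fun p q y.
    rewrite -[x in dot x y](subrK z) addrC dotDl mulrDl lerD //.
      rewrite (le_trans (dpq z y)) // ler_wpM2l ?seminorm_ge0 //.
      by rewrite le_max lexx orbT.
    rewrite dotC (le_trans (dpq y _)) // mulrC ler_wpM2l ?seminorm_ge0 //.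
    by rewrite le_max lexx.
  move=> /le_trans; apply.
  apply: (@le_trans _ _ ((infconv p q x + e / (max_fun p q y + 1)) * max_fun p q y)).
    by rewrite ler_wpM2r // ltW.
  rewrite mulrDl lerD2l -mulrA ler_piMr ?(ltW e0) //.
  by rewrite ler_pdivrMl ?mulr1 ?lerDl // ltr_wpDl.
- rewrite /max_fun ge_max; apply/andP; split.
    by apply: dl => x; rewrite (le_trans (uQ x)) ?infconv_ler.
  by apply: dr => x; rewrite (le_trans (uQ x)) ?infconv_lel.
(* A functional [v] that supports the infimal convolution at [u] is below [p] and below [q], so both
   norms of [v] are at most 1 by duality. *)
- have sQ := seminorm_infconv sp sq.
  have [v [vQ <-]] := hahn_banach u (seminorm_sublinear sQ).
  rewrite dotC (le_trans (uP v)) // /max_fun ge_max; apply/andP; split.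
    by apply: dl => x; rewrite (le_trans (vQ x)) ?infconv_ler.
  by apply: dr => x; rewrite (le_trans (vQ x)) ?infconv_lel.
Qed.

Definition dual_norm p y : R := sup [set dot x y | x in [set x | p x <= 1]].

Section dual_norm.
Variables (p : 'rV[R]_n -> R) (c : R).
Hypotheses (sp : seminorm p) (c0 : 0 < c) (cp : forall x, enorm x <= c * p x).

Lemma dual_norm_has_sup y : has_sup [set dot x y | x in [set x | p x <= 1]].
Proof.
split; first by exists (dot 0 y), 0 => //=; rewrite seminorm0.
exists (c * enorm y) => _ [x /= px <-].
rewrite (le_trans (dot_le_enorm x y)) // ler_wpM2r ?enorm_ge0 //.
by rewrite (le_trans (cp x)) // ler_piMr // ltW.
Qed.

Lemma dot_le_dual_norm x y : p x <= 1 -> dot x y <= dual_norm p y.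
Proof. by move=> px; apply: sup_upper_bound (dual_norm_has_sup y) _ _; exists x. Qed.

Lemma dual_norm_le y m : (forall x, p x <= 1 -> dot x y <= m) -> dual_norm p y <= m.
Proof.
move=> ym; apply: ge_sup; first by have [] := dual_norm_has_sup y.
by move=> _ [x /= px <-]; exact: ym.
Qed.

Lemma seminorm_dual_norm : seminorm (dual_norm p).
Proof.
have dZ a y : dual_norm p (a *: y) <= `|a| * dual_norm p y.
  apply: dual_norm_le => x px; rewrite dotZr.
  have [a0|/ltW a0] := leP 0 a.
    by rewrite ger0_norm // ler_wpM2l // dot_le_dual_norm.
  rewrite ler0_norm // -[a in leLHS]opprK mulNr -mulrN ler_wpM2l ?oppr_ge0 //.
  by rewrite -dotNl dot_le_dual_norm // seminormN.
split=> [x y|a x].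
  apply: dual_norm_le => z pz; rewrite dotDr lerD //; exact: dot_le_dual_norm.
apply/eqP; rewrite eq_le dZ /=.
have [->|a0] := eqVneq a 0.
  rewrite normr0 mul0r; have := @dot_le_dual_norm 0 (0 *: x).
  by rewrite seminorm0 // => /(_ ler01); rewrite dot0l.
rewrite -ler_pdivlMl ?normr_gt0 // -normfV.
by have := dZ a^-1 (a *: x); rewrite scalerK.
Qed.

Lemma dual_pair_dual_norm : dual_pair p (dual_norm p).
Proof.
have dpq x y : dot x y <= p x * dual_norm p y.
  have [px0|px0] := eqVneq (p x) 0.
    have -> : x = 0.
      apply: enorm_eq0; apply/eqP; rewrite eq_le enorm_ge0 andbT.
      by rewrite (le_trans (cp x)) // px0 mulr0.
    by rewrite dot0l seminorm0 ?mul0r.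
  have px : 0 < p x by rewrite lt0r px0 seminorm_ge0.
  rewrite -ler_pdivrMl // -dotZl dot_le_dual_norm //.
  by rewrite sp.2 gtr0_norm ?invr_gt0 // mulVf.
split=> // u uq.
- by apply: dual_norm_le => x px; rewrite dotC (le_trans (uq x)).
(* Bipolar theorem: [v] is below [p], hence of dual norm at most 1, and [dot v u] is [p u]. *)
- have [v [vp <-]] := hahn_banach u (seminorm_sublinear sp).
  rewrite dotC (le_trans (uq v)) //; apply: dual_norm_le => x px.
  by rewrite dotC (le_trans (vp x)).
Qed.

End dual_norm.

(** Matrix determinant lemma: [M *m U] and [U *m M] are block triangular with the same determinant,
    one showing the n by n matrix and the other the scalar. *)
Lemma det_rank1 (u v : 'rV[R]_n) : \det (1%:M + u^T *m v) = 1 + dot u v.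
Proof.
pose M := block_mx (1%:M : 'M[R]_1) (- v) u^T (1%:M : 'M[R]_n).
pose U := block_mx (1%:M : 'M[R]_1) v 0 (1%:M : 'M[R]_n).
have MU : M *m U = block_mx 1%:M 0 u^T (1%:M + u^T *m v).
  by rewrite mulmx_block !(mulmx1, mul1mx, mulmx0, addr0) subrr addrC.
have UM : U *m M = block_mx (1%:M + v *m u^T) 0 u^T 1%:M.
  by rewrite mulmx_block !(mulmx1, mul1mx, mul0mx, add0r, addr0) addNr.
have : \det (M *m U) = \det (U *m M) by rewrite !det_mulmx mulrC.
rewrite MU UM !det_lblock !det1 mul1r mulr1 => ->.
by rewrite det_mx11 [in LHS]mxE [(1%:M : 'M[R]_1) _ _]mxE eqxx mulr1n -/(dot v u) dotC.
Qed.

(** The product is the squared determinant of the stretch in [john_stretch]. It equals 1 at l = 0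
    with derivative a - n > 0, so it exceeds 1 for small l; an explicit l avoids differentiating. *)
Lemma stretch_factor (a : R) : n%:R < a -> (0 < n)%N ->
  exists l, [/\ 0 < l, l < 1 & 1 < (1 - l) ^+ n.-1 * (1 + l * (a - 1))].
Proof.
move=> na n0; have a1 : 1 <= n.-1.+1%:R :> R by rewrite ler1n.
rewrite -(prednK n0) in na; move: (n.-1) na a1 => m na a1.
have bern (l : R) : 0 < l -> l < 1 -> 1 - m%:R * l <= (1 - l) ^+ m.
  move=> l0 l1; elim: m {na a1} => [|m IH]; first by rewrite mul0r subr0.
  have m0 : 0 <= m%:R * (l * l) by rewrite !mulr_ge0 // ltW.
  rewrite exprSr; apply: (@le_trans _ _ ((1 - m%:R * l) * (1 - l))).
    by rewrite -natr1; nra.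
  by rewrite ler_wpM2r // subr_ge0 ltW.
have m0 : 0 <= m%:R :> R by [].
rewrite -natr1 in na a1.
have d0 : 0 < m%:R * (a - 1) + a by nra.
(* With Bernoulli's inequality the product is at least (1 - m l) (1 + l (a - 1)), and this choice of
   [l] makes that bound exactly 1 + l ^ 2 a. *)
pose l := (a - (m%:R + 1)) / (m%:R * (a - 1) + a).
have ld : l * (m%:R * (a - 1) + a) = a - (m%:R + 1) by rewrite mulfVK // gt_eqF.
have l0 : 0 < l by rewrite divr_gt0 // subr_gt0.
have ma0 : 0 <= m%:R * a by rewrite mulr_ge0 //; lra.
have l1 : l < 1 by rewrite ltr_pdivrMr // mul1r; lra.
have a10 : 0 < a - 1 by lra.
exists l; split=> //; have al0 : 0 < 1 + l * (a - 1) by rewrite ltr_wpDr // mulr_ge0 ?ltW.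
apply: lt_le_trans (ler_wpM2r (ltW al0) (bern l l0 l1)).
rewrite -subr_gt0 (_ : _ - 1 = l * (l * a)); first by rewrite mulr_gt0 // mulr_gt0 //; lra.
transitivity (l * (a - (m%:R + 1) - l * (m%:R * (a - 1) + a)) + l * (l * a)); first by ring.
by rewrite ld subrr mulr0 add0r.
Qed.

(* If [x] is a point of the body {p <= 1} of norm greater than [sqrt n], stretching
   the unit ball towards [x], so that [S S^T = (1 - l) I + l x^T x], keeps it inside
   the body and increases its volume for small [l > 0]. *)
Lemma john_stretch p x : seminorm p -> (forall y, p y <= enorm y) ->
  p x <= 1 -> n%:R < dot x x ->
  exists S : 'M[R]_n, 1 < \det S /\ forall v, p (v *m S) <= enorm v.
Proof.
move=> sp pe px na; set a := dot x x in na.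
have n0 : (0 < n)%N.
  rewrite lt0n; apply/eqP => n0; move: na; rewrite n0.
  by rewrite (_ : a = 0) ?ltxx // /a dotE big1 // => i; have := ltn_ord i; rewrite {2}n0.
have [l [l0 l1 ln]] := stretch_factor na n0.
have a0 : 0 < a by apply: le_lt_trans na.
have a1 : 1 <= a by rewrite (le_trans _ (ltW na)) // ler1n.
have al0 : 0 < 1 + l * (a - 1) by nra.
pose s := Num.sqrt (1 + l * (a - 1)); pose b := Num.sqrt (1 - l).
have s2 : s ^+ 2 = 1 + l * (a - 1) by rewrite sqr_sqrtr // ltW.
have b2 : b ^+ 2 = 1 - l by rewrite sqr_sqrtr // subr_ge0 ltW.
have b0 : 0 < b by rewrite sqrtr_gt0 subr_gt0.
have s0 : 0 < s by rewrite sqrtr_gt0.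
(* Chosen so that b + c a = s: the matrix b I + c x^T x has eigenvalue [s] along [x] and [b] on its
   orthogonal complement, the square roots of the eigenvalues of (1 - l) I + l x^T x. *)
pose c := (s - b) / a.
exists (b *: (1%:M + (c / b *: x)^T *m x)); split.
  rewrite detZ det_rank1 dotZl -/a.
  have -> : b ^+ n * (1 + c / b * a) = b ^+ n.-1 * s.
    by rewrite -[in b ^+ n](prednK n0) exprSr /c; field; rewrite !gt_eqF.
  rewrite -(ltr_pXn2r (ltn0Sn 1)) ?nnegrE ?mulr_ge0 ?exprn_ge0 ?(ltW b0) ?(ltW s0) //.
  by rewrite expr1n exprMn s2 -exprM mulnC exprM b2.
move=> v; set w := v *m _.
have [u [up <-]] := hahn_banach w (seminorm_sublinear sp).
have wE : w = b *: v + (c * dot v x) *: x.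
  rewrite /w -scalemxAr mulmxDr mulmx1 scalerDr mulmxA linearZ /= -scalemxAr.
  rewrite -scalemxAl [v *m x^T]mx11_scalar mul_scalar_mx -/(dot v x) !scalerA.
  by congr (_ + _ *: _); field; rewrite gt_eqF.
have u1 : dot u u <= 1.
  have := le_trans (up u) (pe u); rewrite -sqr_enorm => u2.
  have := enorm_ge0 u; have [->|u0] := eqVneq (enorm u) 0; first by rewrite expr0n.
  by rewrite expr2 in u2 *; nra.
have ux : dot u x ^+ 2 <= 1.
  have := le_trans (up x) px; have := up (- x).
  by rewrite dotNr seminormN // => /le_trans/(_ px); nra.
(* The stretch is self-adjoint, so it can be moved onto [u]. The squared norm of the image of [u] is
   (1 - l) dot u u + l (dot u x) ^ 2, a convex combination of numbers at most 1. *)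
have {wE} -> : dot u w = dot v (b *: u + (c * dot u x) *: x).
  by rewrite wE !dotDr !dotZr (dotC u v); ring.
apply: le_trans (dot_le_enorm _ _) _; rewrite ler_piMr ?enorm_ge0 //.
rewrite -(ler_pXn2r (ltn0Sn 1)) ?nnegrE ?enorm_ge0 // expr1n sqr_enorm.
rewrite !(dotDl, dotDr, dotZl, dotZr) (dotC x u) -/a.
rewrite [leLHS](_ : _ = b ^+ 2 * dot u u + (s ^+ 2 - b ^+ 2) / a * dot u x ^+ 2).
  2: by rewrite /c; field; rewrite gt_eqF.
rewrite s2 b2 (_ : _ / a = l); last by field; rewrite gt_eqF.
by move: (dot u u) (dot u x ^+ 2) u1 ux => U X; nra.
Qed.

End seminorms.

(** * Lebesgue measure on R^n: translations *)

Section lebesgue_shift.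
Context (R : realType).
Local Notation Rm := (measurableTypeR R).

Lemma lebesgue_measure_shift (a : R) (A : set Rm) : measurable A ->
  @lebesgue_measure R [set x | A (x + a)] = lebesgue_measure A.
Proof.
move=> mA.
have mf : measurable_fun [set: Rm] (fun x : Rm => (x + a : Rm)).
  exact: measurable_funD.
pose m : {measure set Rm -> \bar R} :=
  measure_function_pushforward__canonical__measure_function_Measure
    (@lebesgue_measure R) mf.
apply: esym; apply: (@lebesgue_measure_unique R m) => // _ [[x y] _ <-].
rewrite /m /= /pushforward.
rewrite (_ : _ @^-1` _ = [set` `]x - a, y - a]]); last first.
  by apply/seteqP; split => z /=; rewrite !in_itv /= ltrBlDr lerBrDr.
rewrite !lebesgue_measure_itv /= !lte_fin ltrD2r; case: ifP => // _.
by rewrite -!EFinD; congr EFin; ring.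
Qed.

(** The measure lives on tuples and the linear algebra on row vectors. [rowt] and [tupr] pass
    between the two; [measurable_rV] and [leb] carry measurability and Lebesgue measure over to row
    vectors. *)
Definition rowt n (t : n.-tuple R) : 'rV[R]_n := \row_i tnth t i.

Definition tupr n (x : 'rV[R]_n) : n.-tuple Rm := [tuple x 0 i | i < n].

Lemma tuprK n : cancel (@tupr n) (@rowt n).
Proof. by move=> x; apply/rowP => i; rewrite mxE tnth_mktuple. Qed.

Lemma rowtK n : cancel (@rowt n) (@tupr n).
Proof. by move=> t; apply: eq_from_tnth => i; rewrite tnth_mktuple mxE. Qed.

Definition measurable_rV n (A : set 'rV[R]_n) := measurable [set t : n.-tuple Rm | A (rowt t)].

Definition leb n (A : set 'rV[R]_n) : \bar R :=
  lebesgue_tuple R n [set t | A (rowt t)].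

Lemma leb_ge0 n (A : set 'rV[R]_n) : (0 <= leb A)%E.
Proof. exact: measure_ge0. Qed.

Lemma le_leb n (A B : set 'rV[R]_n) : measurable_rV A -> measurable_rV B -> A `<=` B ->
  (leb A <= leb B)%E.
Proof. by move=> mA mB AB; apply: le_measure; rewrite ?inE // => t; exact: AB. Qed.

Lemma measurable_tupr d (T : measurableType d) n (f : T -> 'rV[R]_n) :
  (forall i, measurable_fun [set: T] (fun x => f x 0 i)) ->
  measurable_fun [set: T] (fun x => tupr (f x)).
Proof.
move=> mf; apply/measurable_fun_tnthP => i.
by apply: eq_measurable_fun (mf i) => x _; rewrite /= tnth_mktuple.
Qed.

Lemma measurable_mulmx d (T : measurableType d) n (f : T -> 'rV[R]_n) (M : 'M[R]_n) :
  (forall i, measurable_fun [set: T] (fun x => f x 0 i)) ->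
  forall i, measurable_fun [set: T] (fun x => (f x *m M) 0 i).
Proof.
move=> mf i; under eq_fun do rewrite mxE.
apply: measurable_sum => j; apply: measurable_funM => //.
Qed.

Lemma measurable_preimage_rV d (T : measurableType d) n (f : T -> 'rV[R]_n) (A : set 'rV[R]_n) :
  (forall i, measurable_fun [set: T] (fun x => f x 0 i)) -> measurable_rV A ->
  measurable [set x | A (f x)].
Proof.
move=> /measurable_tupr mf mA; have := mf measurableT _ mA; rewrite setTI.
by congr measurable; apply/seteqP; split => x /=; rewrite tuprK.
Qed.

Lemma measurable_rowt n (i : 'I_n) :
  measurable_fun [set: n.-tuple Rm] (fun t => rowt t 0 i).
Proof. by under eq_fun do rewrite mxE; exact: measurable_tnth. Qed.

(** By induction on [n]: through [cons_tup] a translation acts on each factor of a product, and the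
    translated product measure agrees with the original one on rectangles, which determines it. *)
Lemma leb_shift n (a : 'rV[R]_n) (A : set 'rV[R]_n) : measurable_rV A ->
  leb [set x | A (x + a)] = leb A.
Proof.
elim: n a A => [|n IH] a A mA.
  have xa (x : 'rV[R]_0) : x + a = x by apply/rowP => -[].
  by under eq_set do rewrite xa.
pose h (p : Rm * n.-tuple Rm) : Rm * n.-tuple Rm :=
  (p.1 + a 0 ord0, tupr (rowt p.2 + rsubmx (a : 'rV_(1 + n)))).
have mh : measurable_fun [set: Rm * n.-tuple Rm] h.
  apply/measurable_fun_pairP; split; first exact: measurable_funD.
  apply: measurable_tupr => i; under eq_fun do rewrite mxE.
  apply: measurable_funD => //; apply: (measurableT_comp (measurable_rowt i)).
  exact: measurable_snd.
pose mu := (@lebesgue_measure R \x lebesgue_tuple R n)%E.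
pose m : {measure set (Rm * n.-tuple Rm) -> \bar R} :=
  measure_function_pushforward__canonical__measure_function_Measure mu mh.
have mB : measurable ((@cons_tup Rm n) @^-1` [set t | A (rowt t)]).
  by rewrite -[X in measurable X]setTI; exact: measurable_cons_tup.
have hE p : rowt (cons_tup (h p)) = rowt (cons_tup p) + a.
  apply/rowP => i; rewrite !mxE; case: (unliftP ord0 i) => [j ->|->] //=.
  rewrite !tnthS /= tnth_mktuple !mxE; congr (_ + a 0 _); exact: val_inj.
transitivity (m ((@cons_tup Rm n) @^-1` [set t | A (rowt t)])).
  rewrite /leb /= /cons_measure /pushforward; congr (mu _).
  by apply/seteqP; split => p /=; rewrite hE.
apply: esym; apply: product_measure_unique => // X Y mX mY.
rewrite /m /= /pushforward (_ : _ @^-1` _ = [set x | X (x + a 0 ord0)] `*`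
  [set t | Y (tupr (rowt t + rsubmx (a : 'rV_(1 + n))))]) //.
have mY' : measurable_rV [set x | Y (tupr x)].
  by rewrite /measurable_rV; under eq_set do rewrite /= rowtK.
rewrite product_measure1E; last 2 first.
- rewrite -[X in measurable X]setTI.
  by have : measurable_fun [set: Rm] (fun x : Rm => (x + a 0 ord0 : Rm));
    [exact: measurable_funD | apply].
- apply: (@measurable_preimage_rV _ _ _ (fun t => rowt t + _) _ _ mY') => i.
  under eq_fun do rewrite mxE.
  by apply: measurable_funD => //; exact: measurable_rowt.
congr (_ * _)%E; first exact: (lebesgue_measure_shift (a 0 ord0) mX).
rewrite -[LHS]/(leb [set x | [set x | Y (tupr x)] (x + rsubmx (a : 'rV_(1 + n)))]).
by rewrite IH // /leb; under eq_set do rewrite /= rowtK.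
Qed.

End lebesgue_shift.

(** * Lebesgue measure on R^n: linear maps *)

Section linear_change_of_variables.
Context (R : realType).
Local Notation Rm := (measurableTypeR R).
Local Notation L n := (lebesgue_tuple R n).

Lemma leb_fubini n (E : 'rV[R]_n -> 'rV[R]_n -> Prop) :
  measurable [set p : n.-tuple Rm * n.-tuple Rm | E (rowt p.1) (rowt p.2)] ->
  (\int[L n]_t leb [set y : 'rV[R]_n | E (rowt t) y] =
   \int[L n]_t leb [set x : 'rV[R]_n | E x (rowt t)])%E.
Proof.
move=> mE; have := indic_fubini_tonelli (L n) (L n) mE.
rewrite indic_fubini_tonelli_FE // indic_fubini_tonelli_GE //.
have xE (t : n.-tuple Rm) : leb [set y : 'rV[R]_n | E (rowt t) y] = (L n \o
    xsection [set p : n.-tuple Rm * n.-tuple Rm | E (rowt p.1) (rowt p.2)]) t.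
  by congr (L n _); apply/seteqP; split => s /=; rewrite /xsection /= in_setE.
have yE (t : n.-tuple Rm) : leb [set x : 'rV[R]_n | E x (rowt t)] = (L n \o
    ysection [set p : n.-tuple Rm * n.-tuple Rm | E (rowt p.1) (rowt p.2)]) t.
  by congr (L n _); apply/seteqP; split => s /=; rewrite /ysection /= in_setE.
by move=> eqE; under eq_integral do rewrite xE; under [RHS]eq_integral do rewrite yE.
Qed.

Lemma integral_leb_cst n (A : set 'rV[R]_n) (f : n.-tuple Rm -> \bar R) k :
  measurable_rV A -> (forall t, A (rowt t) -> f t = k) -> (forall t, ~ A (rowt t) -> f t = 0%E) ->
  (\int[L n]_t f t = k * leb A)%E.
Proof.
move=> mA fA fN.
rewrite /leb -(integral_cst (L n) (mA : measurable [set t | A (rowt t)])).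
rewrite [RHS]integral_mkcond.
apply: eq_integral => t _; rewrite /patch; case: ifPn; rewrite (in_setE, notin_setE) /=.
  by move=> /fA.
by move=> /fN.
Qed.

Lemma leb0 n : leb (set0 : set 'rV[R]_n) = 0%E.
Proof. exact: measure0. Qed.

Lemma measurable_rV_mulmx n (M : 'M[R]_n) A : measurable_rV A ->
  measurable_rV [set x : 'rV[R]_n | A (x *m M)].
Proof.
by move=> mA; apply: (measurable_preimage_rV (f := fun t => rowt t *m M) _ mA);
  exact: measurable_mulmx (@measurable_rowt R n).
Qed.

(* Uniqueness of Haar measure: both sides are the measure of the pairs (x, y) with
   x M + y in A and y in B, computed in the two orders of integration. *)
Lemma leb_haar n (M : 'M[R]_n) (A B : set 'rV[R]_n) : M \in unitmx ->
  measurable_rV A -> measurable_rV B -> (forall x, B (- x) <-> B x) ->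
  (leb [set x : 'rV[R]_n | A (x *m M)] * leb B = leb [set x : 'rV[R]_n | B (x *m M)] * leb A)%E.
Proof.
move=> uM mA mB symB.
have mM (C : set 'rV[R]_n) := @measurable_rV_mulmx n M C.
pose E x y := A (x *m M + y) /\ B y.
(* [F] is [E] after translating [y] by [x *m M]. The symmetry of [B] turns [B (y - x *m M)] into
   [B (x *m M - y)], whose section in [x] is a translate of the preimage of [B]. *)
pose F x y := A y /\ B (y - x *m M).
have m1 i : measurable_fun [set: n.-tuple Rm * n.-tuple Rm] (fun p => rowt p.1 0 i).
  exact: measurableT_comp (measurable_rowt i) measurable_fst.
have m2 i : measurable_fun [set: n.-tuple Rm * n.-tuple Rm] (fun p => rowt p.2 0 i).
  exact: measurableT_comp (measurable_rowt i) measurable_snd.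
have mE : measurable [set p : n.-tuple Rm * n.-tuple Rm | E (rowt p.1) (rowt p.2)].
  apply: measurableI; last exact: measurable_preimage_rV m2 mB.
  apply: (measurable_preimage_rV _ mA) => i; under eq_fun do rewrite mxE.
  by apply: measurable_funD => //; exact: measurable_mulmx.
have mF : measurable [set p : n.-tuple Rm * n.-tuple Rm | F (rowt p.1) (rowt p.2)].
  apply: measurableI; first exact: measurable_preimage_rV m2 mA.
  apply: (measurable_preimage_rV _ mB) => i; under eq_fun do rewrite mxE [X in _ + X]mxE.
  by apply: measurable_funB => //; exact: measurable_mulmx.
transitivity (\int[L n]_t leb [set x : 'rV[R]_n | E x (rowt t)])%E.
  apply/esym/integral_leb_cst => // t Bt.
    rewrite -(leb_shift (rowt t *m invmx M) (mM _ mA)); congr leb.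
    by apply/seteqP; split => x /=; rewrite mulmxDl mulmxKV // /E; tauto.
  by rewrite -(leb0 n); congr leb; apply/seteqP; split => x //= [].
rewrite -leb_fubini //.
transitivity (\int[L n]_t leb [set y : 'rV[R]_n | F (rowt t) y])%E.
  apply: eq_integral => t _; have mFt : measurable_rV [set y : 'rV[R]_n | F (rowt t) y].
    apply: measurableI => //; apply: (measurable_preimage_rV _ mB) => i.
    under eq_fun do rewrite mxE; apply: measurable_funD => //.
    exact: measurable_rowt.
  rewrite -(leb_shift (rowt t *m M) mFt); congr leb.
  by apply/seteqP; split => x /=; rewrite /F addrK addrC.
rewrite leb_fubini //; apply: integral_leb_cst => // t At.
  rewrite -(leb_shift (- (rowt t *m invmx M)) (mM _ mB)); congr leb.
  apply/seteqP; split => x /=; rewrite mulmxDl mulNmx mulmxKV // /F.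
    by move=> [_ ?]; apply/symB; rewrite opprB.
  by move=> ?; split => //; apply/symB; rewrite opprB.
by rewrite -(leb0 n); congr leb; apply/seteqP; split => x //= [].
Qed.

Definition cube n : set 'rV[R]_n := [set x : 'rV[R]_n | forall i, -1 <= x 0 i <= 1].

Lemma cubeE n (s : R) : [set t : n.-tuple Rm | forall i, - s <= rowt t 0 i <= s] =
  [set t | forall i, `[- s, s]%classic (tnth t i)].
Proof.
by apply/seteqP; split => t /= Qt i; have := Qt i; rewrite mxE in_itv.
Qed.

Lemma measurable_rV_box n (s : R) : measurable_rV [set x : 'rV[R]_n | forall i, - s <= x 0 i <= s].
Proof.
rewrite /measurable_rV /= cubeE.
rewrite (_ : mkset _ = \bigcap_(i in [set: 'I_n])
    ((fun t => tnth t i) @^-1` `[- s, s]%classic)).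
  apply: fin_bigcap_measurable => // i _.
  by rewrite -[X in measurable X]setTI; exact: measurable_tnth.
by apply/seteqP; split=> [t Ht i _|t Ht i]; [exact: Ht|exact: (Ht i I)].
Qed.

Lemma leb_box n (s : R) : 0 <= s ->
  leb [set x : 'rV[R]_n | forall i, - s <= x 0 i <= s] = ((2 * s) ^+ n)%:E.
Proof.
move=> s0; rewrite /leb /= cubeE (lebesgue_tuple_box (A := fun=> `[- s, s]%classic)) //.
rewrite (eq_bigr (fun=> (2 * s)%:E)) ?prodEFin ?prodr_const ?card_ord // => i _.
rewrite lebesgue_measure_itv /= lte_fin; case: ltP => ss.
  by rewrite -EFinD; congr EFin; ring.
by congr EFin; lra.
Qed.

(** The measure is taken of a preimage, so [r] will turn out to be the inverse of the absolute
    determinant. *)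
Definition scales n (M : 'M[R]_n) (r : R) :=
  forall A, measurable_rV A -> leb [set x : 'rV[R]_n | A (x *m M)] = (r%:E * leb A)%E.

Lemma measurable_rV_cube n : measurable_rV (@cube n). Proof. exact: measurable_rV_box. Qed.

Lemma leb_cube n : leb (@cube n) = (2 ^+ n)%:E.
Proof. by rewrite leb_box ?mulr1. Qed.

Lemma cubeN n (x : 'rV[R]_n) : cube (- x) <-> cube x.
Proof. by split => Qx i; have := Qx i; rewrite mxE; lra. Qed.

(** By [leb_haar] the ratio of measures is the same for every set, so it can be read off from one
    symmetric set of finite nonzero measure. *)
Lemma scales_cube n (M : 'M[R]_n) r : M \in unitmx ->
  leb [set x : 'rV[R]_n | cube (x *m M)] = (r * 2 ^+ n)%:E -> scales M r.
Proof.
move=> uM cM A mA.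
have haar : (leb [set x : 'rV[R]_n | A (x *m M)] * (2 ^+ n)%:E = (r * 2 ^+ n)%:E * leb A)%E.
  by rewrite -cM -leb_cube; exact: (leb_haar uM mA (@measurable_rV_cube n) (@cubeN n)).
have n0 : (2 ^+ n : R) != 0 by rewrite expf_neq0.
have -> : leb [set x : 'rV[R]_n | A (x *m M)] =
    (leb [set x : 'rV[R]_n | A (x *m M)] * (2 ^+ n)%:E * ((2 ^+ n)^-1)%:E)%E.
  by rewrite -muleA -EFinM divff // mule1.
by rewrite haar muleAC -EFinM mulfK.
Qed.

Lemma scales_uniq n (M : 'M[R]_n) r s : scales M r -> scales M s -> r = s.
Proof.
move=> sr ss; have := ss _ (@measurable_rV_cube n); rewrite (sr _ (@measurable_rV_cube n)).
by rewrite leb_cube -!EFinM => -[] /mulIf; apply; rewrite expf_neq0.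
Qed.

Lemma scalesM n (M N : 'M[R]_n) r s : scales M r -> scales N s -> scales (M *m N) (r * s).
Proof.
move=> sM sN A mA; rewrite EFinM -muleA -sN // -sM; last exact: measurable_rV_mulmx.
by under eq_set do rewrite mulmxA.
Qed.

Lemma scales1 n : scales (1%:M : 'M[R]_n) 1.
Proof. by move=> A mA; under eq_set do rewrite mulmx1; rewrite mul1e. Qed.

(** Applying [leb_haar] to the cube and its preimage under the inverse shows that the preimages of
    the cube under [M] and [invmx M] have measures with a finite nonzero product, so the first is
    finite and nonzero. *)
Lemma scales_exists n (M : 'M[R]_n) : M \in unitmx -> exists2 r, r != 0 & scales M r.
Proof.
move=> uM; pose c (N : 'M[R]_n) := leb [set x : 'rV[R]_n | cube (x *m N)].
have cc : (c M * c (invmx M) = (2 ^+ n * 2 ^+ n)%:E)%E.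
  have symC (x : 'rV[R]_n) : cube (- x *m invmx M) <-> cube (x *m invmx M).
    by rewrite mulNmx; exact: cubeN.
  have := leb_haar uM (@measurable_rV_cube n) (measurable_rV_mulmx _ (@measurable_rV_cube n)) symC.
  rewrite -/(c M) -/(c (invmx M)) => ->.
  rewrite (_ : mkset _ = @cube n) ?leb_cube //.
  by apply/seteqP; split => x /=; rewrite mulmxK.
have c0 : (c (invmx M) != 0)%E.
  by apply: contra_eq_neq cc => ->; rewrite mule0 eqe eq_sym mulf_neq0 ?expf_neq0.
have cfin : c M \is a fin_num.
  rewrite ge0_fin_numE ?leb_ge0 // ltNge leye_eq; apply: contra_eqN cc => /eqP ->.
  by rewrite gt0_mulye // lt0e c0 leb_ge0.
have n0 : (2 ^+ n : R) != 0 by rewrite expf_neq0.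
exists (fine (c M) / 2 ^+ n); last by apply: scales_cube => //; rewrite mulfVK // fineK.
apply: contra_eq_neq cc => /eqP.
rewrite mulf_eq0 invr_eq0 (negbTE n0) orbF => /eqP cM0.
by rewrite -(fineK cfin) cM0 mul0e eqe eq_sym mulf_neq0.
Qed.

(** A matrix conjugate to its own square has a factor with r = r ^ 2, and r is nonzero. This settles
    shears without integrating. *)
Lemma scales_conj n (D M : 'M[R]_n) : D \in unitmx -> M \in unitmx ->
  M *m D = D *m (M *m M) \/ D *m M = (M *m M) *m D -> scales M 1.
Proof.
move=> uD uM eMD; have [d d0 sD] := scales_exists uD; have [r r0 sM] := scales_exists uM.
suff : r * d = r * (r * d).
  move=> /(mulfI r0) /esym/eqP; rewrite -subr_eq0 -{2}[d]mul1r -mulrBl mulf_eq0.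
  by rewrite (negbTE d0) orbF subr_eq0 => /eqP r1; rewrite r1 in sM.
case: eMD => eMD.
  have := scalesM sD (scalesM sM sM); rewrite -eMD => /(scales_uniq (scalesM sM sD)).
  by move=> {1}->; ring.
have := scalesM (scalesM sM sM) sD; rewrite -eMD => /(scales_uniq (scalesM sD sM)).
by rewrite mulrC => {1}->; ring.
Qed.

(** Doubling the first coordinate conjugates the shear by [v] to the shear by [2 v], which is its
    square. *)
Lemma scales_lblock n (v : 'cV[R]_n) : scales (block_mx (1%:M : 'M[R]_1) 0 v 1%:M) 1.
Proof.
pose D := block_mx (2%:M : 'M[R]_1) 0 0 (1%:M : 'M[R]_n).
apply: (@scales_conj _ D).
- by rewrite unitmxE det_ublock det_scalar1 det1 mulr1 unitfE.
- by rewrite unitmxE det_lblock !det1 mulr1 unitr1.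
left; rewrite !mulmx_block !(mulmx1, mul1mx, mulmx0, mul0mx, addr0, add0r).
by rewrite mul_mx_scalar scaler_nat mulr2n.
Qed.

Lemma scales_ublock n (v : 'rV[R]_n) : scales (block_mx (1%:M : 'M[R]_1) v 0 1%:M) 1.
Proof.
pose D := block_mx (2%:M : 'M[R]_1) 0 0 (1%:M : 'M[R]_n).
apply: (@scales_conj _ D).
- by rewrite unitmxE det_ublock det_scalar1 det1 mulr1 unitfE.
- by rewrite unitmxE det_ublock !det1 mulr1 unitr1.
right; rewrite !mulmx_block !(mulmx1, mul1mx, mulmx0, mul0mx, addr0, add0r).
by rewrite mul_scalar_mx scaler_nat mulr2n.
Qed.

Lemma scales_tperm n (i j : 'I_n) : scales (tperm_mx i j : 'M[R]_n) 1.
Proof.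
apply: scales_cube; first by rewrite unitmx_perm.
rewrite mul1r -leb_cube; congr leb; apply/seteqP.
split => x /= Qx k; last by rewrite -xcolE mxE; exact: Qx.
by have := Qx (tperm i j k); rewrite -xcolE mxE tpermK.
Qed.

Lemma scales_diag n (a : R) (M : 'M[R]_n) r : a != 0 -> M \in unitmx -> scales M r ->
  scales (block_mx (a%:M : 'M[R]_1) 0 0 M) (`|a|^-1 * r).
Proof.
move=> a0 uM sM; apply: scales_cube.
  by rewrite unitmxE det_ublock det_scalar1 unitrM unitfE a0 -unitmxE.
pose I : set Rm := `[- `|a|^-1, `|a|^-1]%classic.
pose C : set (n.-tuple Rm) := [set t | cube (rowt t *m M)].
have mC : measurable C by exact: (measurable_rV_mulmx M (@measurable_rV_cube n)).
rewrite /leb /= /cons_measure /pushforward (_ : _ @^-1` _ = I `*` C); last first.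
  have na : 0 < `|a| by rewrite normr_gt0.
  have Ia (x : R) : (- 1 <= x * a <= 1) = (- `|a|^-1 <= x <= `|a|^-1).
    by rewrite -!ler_norml normrM -ler_pdivlMr // mul1r.
  have E (x : Rm) (t : n.-tuple Rm) : rowt (cons_tup (x, t)) = row_mx (x%:M : 'M[R]_1) (rowt t).
    apply/rowP => i; rewrite [LHS]mxE; case: (split_ordP (i : 'I_(1 + n))) => j ->.
      by rewrite [RHS](row_mxEl (x%:M : 'M[R]_1)) mxE (ord1 j) eqxx mulr1n.
    rewrite [RHS](row_mxEr (x%:M : 'M[R]_1)) mxE.
    rewrite (_ : rshift 1 j = lift ord0 j); last exact: val_inj.
    by rewrite tnthS; congr tnth; exact: val_inj.
  apply/seteqP; split => -[x t] /=; rewrite E mul_row_block !(mulmx0, addr0, add0r).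
    rewrite -scalar_mxM => Q; split.
      by rewrite /I /= in_itv /= -Ia; have := Q (lshift n ord0); rewrite row_mxEl mxE eqxx mulr1n.
    by move=> i; have := Q (rshift 1 i); rewrite row_mxEr.
  rewrite -scalar_mxM /I /= in_itv /= -Ia => -[Ix Qt] i.
  case: (split_ordP (i : 'I_(1 + n))) => j ->.
    by rewrite row_mxEl mxE (ord1 j) eqxx mulr1n.
  by rewrite row_mxEr; exact: Qt.
rewrite product_measure1E //; last exact: measurable_itv.
rewrite -[X in (_ * X)%E]/(leb [set x : 'rV[R]_n | cube (x *m M)]).
rewrite sM ?leb_cube; last exact: measurable_rV_cube.
have lI : @lebesgue_measure R I = (2 * `|a|^-1)%:E.
  rewrite [LHS]lebesgue_measure_itv /= lte_fin gtrN ?invr_gt0 ?normr_gt0 // -EFinD.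
  by congr EFin; ring.
transitivity ((2 * `|a|^-1)%:E * (r%:E * (2 ^+ n)%:E))%E; first by congr (_ * _)%E; exact: lI.
by rewrite -!EFinM; congr EFin; rewrite exprS; ring.
Qed.

(** Gaussian elimination: a transposition of columns brings a nonzero pivot to the corner, and the
    matrix then splits as a lower shear, a block diagonal matrix with the Schur complement [S], and
    an upper shear. *)
Theorem scales_det n (M : 'M[R]_n) : M \in unitmx -> scales M `|\det M|^-1.
Proof.
elim: n M => [|n IH] M uM.
  rewrite (flatmx0 M) -(flatmx0 1%:M) det1 normr1 invr1; exact: scales1.
have [j Mj] : exists j, M 0 j != 0.
  apply/existsP; rewrite -negb_forall; apply/negP => /forallP M0.
  move: uM; rewrite unitmxE unitfE (expand_det_row _ 0) big1 ?eqxx // => j _.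
  by rewrite (eqP (M0 j)) mul0r.
pose N : 'M[R]_(1 + n) := M *m tperm_mx 0 j.
have N0 : N 0 0 != 0 by rewrite /N -xcolE mxE tpermL.
have ME : M = N *m tperm_mx 0 j by rewrite /N -mulmxA -perm_mxM tperm2 perm_mx1 mulmx1.
have uN : N \in unitmx by rewrite unitmx_mul uM unitmx_perm.
clearbody N.
have -> : `|\det M| = `|\det N|.
  by rewrite ME det_mulmx normrM det_perm normrX normrN1 expr1n mulr1.
rewrite ME -[X in scales _ X]mulr1; apply: scalesM; last exact: scales_tperm.
set a := N 0 0 in N0; pose S := drsubmx N - dlsubmx N *m (a^-1 *: ursubmx N).
have NE : N = block_mx (1%:M : 'M[R]_1) 0 (a^-1 *: dlsubmx N) 1%:M *m
    block_mx (a%:M : 'M[R]_1) 0 0 S *m block_mx (1%:M : 'M[R]_1) (a^-1 *: ursubmx N) 0 1%:M.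
  rewrite !mulmx_block !(mulmx1, mul1mx, mulmx0, mul0mx, addr0, add0r).
  rewrite mul_mx_scalar mul_scalar_mx !scalerA mulfV // !scale1r.
  rewrite /S addrC subrK -[LHS]submxK; congr block_mx.
  by apply/rowP => i; rewrite (ord1 i) !mxE eqxx mulr1n; congr (N _ _); exact: val_inj.
have dN : \det N = a * \det S.
  by rewrite NE !det_mulmx !det_ublock det_lblock !det1 det_scalar1 !mul1r !mulr1.
have uS : S \in unitmx.
  by move: uN; rewrite !unitmxE !unitfE dN mulf_eq0 negb_or => /andP[].
have := scalesM (scalesM (scales_lblock (a^-1 *: dlsubmx N)) (scales_diag N0 uS (IH _ uS)))
  (scales_ublock (a^-1 *: ursubmx N)).
by rewrite -NE mul1r mulr1 dN normrM invfM.
Qed.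

End linear_change_of_variables.

(** * Exponential integrals *)

Section exponential_integral.
Context (R : realType).
Local Notation Rm := (measurableTypeR R).

(** The layer-cake kernel: integrating over [x] gives [expR (- s)] for s >= 0. The condition [0 < x]
    then removes at most a null set and leaves only sublevel sets of positive radius. *)
Definition cut_exp (s x : R) : R := if (0 < x) && (s <= x) then expR (- x) else 0.

Lemma cut_exp_ge0 s x : 0 <= cut_exp s x.
Proof. by rewrite /cut_exp; case: ifP => // _; exact: expR_ge0. Qed.

Lemma measurable_cut_exp d (T : measurableType d) (f g : T -> R) :
  measurable_fun [set: T] f -> measurable_fun [set: T] g ->
  measurable_fun [set: T] (fun t => cut_exp (f t) (g t)).
Proof.
move=> mf mg; apply: measurable_fun_ifT => //.
  by apply: measurable_and; [exact: measurable_fun_ltr|exact: measurable_fun_ler].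
by apply: (measurableT_comp (@measurable_expR R)); exact: measurableT_comp.
Qed.

Lemma integral_expRN (s : R) :
  (\int[lebesgue_measure]_(x in `[s, +oo[) (expR (- x))%:E = (expR (- s))%:E)%E.
Proof.
have cE : continuous (fun x : R => expR (- x)).
  by move=> x; apply: continuous_comp; [exact: opp_continuous|exact: continuous_expR].
have dE (x : R) : is_derive x 1 (fun x => - expR (- x)) (expR (- x)).
  by apply: is_derive_eq; rewrite mulrN1 opprK.
rewrite (@ge0_continuous_FTC2y _ _ (fun x => - expR (- x)) _ 0).
- by rewrite EFinN oppeK add0e.
- by move=> x _; exact: expR_ge0.
- exact: continuous_subspaceT.
- by rewrite -oppr0; apply: cvgN; exact: cvgr_expR.
- by move=> x _; exact: ex_derive.
- by apply: cvgN; apply: cvg_at_right_filter; exact: cE.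
- by move=> x _; rewrite derive1E; exact: derive_val.
Qed.

Lemma integral_cut_exp (s : R) : 0 <= s ->
  (\int[lebesgue_measure]_x (cut_exp s x)%:E = (expR (- s))%:E)%E.
Proof.
move=> s0; have mE (D : set R) : measurable_fun D (fun x => (expR (- x))%:E).
  apply/measurable_EFinP/measurable_funTS; apply: (measurableT_comp (@measurable_expR R)).
  exact: measurable_funN.
rewrite -integral_expRN -integral_itv_obnd_cbnd // [RHS]integral_itv_obnd_cbnd //.
have [->|sn0] := eqVneq s 0.
  rewrite -integral_itv_obnd_cbnd // [RHS]integral_mkcond; apply: eq_integral => x _.
  rewrite /cut_exp patchE; case: ifPn => [/andP[x0 _]|]; case: ifPn => //.
    by rewrite notin_setE /= in_itv /= x0.
  by rewrite in_setE /= in_itv /= andbT => x0; rewrite x0 ltW.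
rewrite [RHS]integral_mkcond; apply: eq_integral => x _.
rewrite /cut_exp patchE; case: ifPn => [/andP[_ x0]|]; case: ifPn => //.
  by rewrite notin_setE /= in_itv /= x0.
rewrite in_setE /= in_itv /= andbT => sx; rewrite sx andbT.
by rewrite (lt_le_trans _ sx) // lt0r sn0.
Qed.

(** This is Gamma (n + 1); being positive and finite, it cancels in [vball_infconv]. *)
Definition gamma_int n : \bar R :=
  (\int[lebesgue_measure]_x (cut_exp 0 x * x ^+ n)%:E)%E.

Lemma cut_exp0_pow_ge0 n (x : R) : 0 <= cut_exp 0 x * x ^+ n.
Proof.
rewrite /cut_exp; case: ifP => [/andP[x0 _]|_]; last by rewrite mul0r.
by rewrite mulr_ge0 ?expR_ge0 // exprn_ge0 // ltW.
Qed.

Lemma measurable_cut_exp_pow n :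
  measurable_fun [set: R] (fun x : R => (cut_exp 0 x * x ^+ n)%:E).
Proof.
apply/measurable_EFinP; apply: measurable_funM; first exact: measurable_cut_exp.
exact: measurable_funX.
Qed.

Lemma gamma_int_gt0 n : (0 < gamma_int n)%E.
Proof.
apply: (@lt_le_trans _ _ (\int[lebesgue_measure]_x (cut_exp 1 x)%:E)%E).
  by rewrite integral_cut_exp // lte_fin expR_gt0.
apply: ge0_le_integral => //.
- by move=> x _; rewrite lee_fin cut_exp_ge0.
- by apply/measurable_EFinP; exact: measurable_cut_exp.
- exact: measurable_cut_exp_pow.
- move=> x _; rewrite lee_fin {1}/cut_exp; case: ifPn => [/andP[x0 x1]|_].
    by rewrite /cut_exp x0 (ltW x0) ler_peMr ?expR_ge0 // exprn_ege1.
  exact: cut_exp0_pow_ge0.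
Qed.

Lemma gamma_int_lty n : (gamma_int n < +oo)%E.
Proof.
(* From y <= exp y at y = x / (2 (n + 1)) one gets x ^ n <= (2 (n + 1)) ^ n exp (x / 2). The last
   factor 2 offsets the rate 1/2 of the exponential density, and n + 1 avoids dividing by zero. *)
pose C : R := (2 * n.+1%:R) ^+ n * 2.
have m0 : 0 < 2 * n.+1%:R :> R by rewrite mulr_gt0.
have C0 : 0 <= C by rewrite mulr_ge0 // exprn_ge0 // ltW.
apply: (@le_lt_trans _ _ (\int[lebesgue_measure]_x (C%:E * (exponential_pdf 2^-1 x)%:E))%E).
  apply: ge0_le_integral => //.
  - by move=> x _; rewrite lee_fin cut_exp0_pow_ge0.
  - exact: measurable_cut_exp_pow.
  - by apply: measurable_funeM; apply/measurable_EFinP; exact: measurable_exponential_pdf.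
  - move=> x _; rewrite -EFinM lee_fin /cut_exp; case: ifPn => [/andP[x0 _]|_]; last first.
      by rewrite mul0r mulr_ge0 // exponential_pdf_ge0 // invr_ge0.
    rewrite /exponential_pdf patchE mem_set; last by rewrite /= in_itv /= ltW.
    have xe : x ^+ n <= (2 * n.+1%:R) ^+ n * expR (x / 2).
      have xn : x / (2 * n.+1%:R) <= expR (x / (2 * n.+1%:R)).
        by apply: le_trans (expR_ge1Dx _); rewrite lerDr.
      rewrite -[x in x ^+ n](mulfVK (lt0r_neq0 m0)) exprMn mulrC ler_wpM2l ?exprn_ge0 ?(ltW m0) //.
      apply: (@le_trans _ _ (expR (x / (2 * n.+1%:R)) ^+ n)).
        by rewrite lerXn2r // ?nnegrE ?expR_ge0 // divr_ge0 // ltW.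
      rewrite -expRM_natl ler_expR (_ : _ * _ = x / 2 * (n%:R / n.+1%:R)).
        by rewrite ler_piMr ?divr_ge0 ?(ltW x0) // ler_pdivrMr // mul1r ler_nat.
      have n1 : n.+1%:R != 0 :> R by rewrite pnatr_eq0.
      by move: (n.+1%:R : R) n1 => m n1; field.
    rewrite (_ : C * _ = expR (- x) * ((2 * n.+1%:R) ^+ n * expR (x / 2))).
      by rewrite ler_wpM2l ?expR_ge0.
    rewrite [RHS]mulrCA -expRD /C -[LHS]mulrA; congr (_ * _).
    by rewrite mulrA divff // mul1r; congr expR; field.
rewrite ge0_integralZl_EFin //.
- by rewrite integral_exponential_pdf ?mule1 ?ltry // invr_gt0.
- by move=> x _; rewrite lee_fin exponential_pdf_ge0 // invr_ge0.
- by apply/measurable_EFinP; exact: measurable_exponential_pdf.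
Qed.

End exponential_integral.

(** * Unit balls of seminorms and integrals of exp (- p) *)

Section seminorm_integrals.
Context (R : realType) (n : nat).
Local Notation Rm := (measurableTypeR R).
Local Notation L := (lebesgue_tuple R n).
Implicit Types (p q : 'rV[R]_n -> R).

Lemma seminorm_le_coord p (x : 'rV[R]_n) : seminorm p ->
  p x <= \sum_i `|x 0 i| * p (delta_mx 0 i).
Proof.
move=> sp; rewrite [x in p x]row_sum_delta.
elim/big_rec2 : _ => [|i y1 y2 _ le12]; first by rewrite seminorm0.
by apply: le_trans (sp.1 _ _) _; rewrite sp.2 lerD2l.
Qed.

Lemma seminorm_triangle p (x y : 'rV[R]_n) : seminorm p -> p x <= p y + p (x - y).
Proof. by move=> sp; have := sp.1 y (x - y); rewrite addrC subrK. Qed.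

(* [p] is Lipschitz, so {p < c} is a countable union of sets defined from the
   rational points. *)
Lemma measurable_seminorm p : seminorm p ->
  measurable_fun [set: n.-tuple Rm] (fun t => p (rowt t)).
Proof.
move=> sp; pose w (x : 'rV[R]_n) := \sum_i `|x 0 i| * p (delta_mx 0 i).
apply: (measurability _ (RGenInftyO.measurableE R)) => _ [_ [c ->] <-]; rewrite setTI.
pose qr (q : n.-tuple rat) : 'rV[R]_n := \row_i ratr (tnth q i).
have -> : (fun t : n.-tuple Rm => p (rowt t)) @^-1` [set` `]-oo, c[] =
    \bigcup_q [set t | p (qr q) + w (rowt t - qr q) < c].
  apply/seteqP; split => t /=; rewrite in_itv /=; last first.
    move=> [q _ /=]; apply: le_lt_trans.
    rewrite (le_trans (seminorm_triangle (rowt t) (qr q) sp)) //.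
    by rewrite lerD2l; exact: seminorm_le_coord.
  move=> pc; pose S := \sum_i p (delta_mx 0 i : 'rV[R]_n).
  have S0 : 0 <= S by apply: sumr_ge0 => i _; exact: seminorm_ge0.
  (* Passing to the rational point and back costs at most 2 d S, so [d] keeps this below the gap c -
     p; adding 1 to [S] covers S = 0. *)
  pose d := (c - p (rowt t)) / (2 * (S + 1)).
  have d0 : 0 < d by rewrite divr_gt0 ?subr_gt0 // mulr_gt0 // ltr_wpDl.
  have : forall i, exists r : rat, `|tnth t i - ratr r| < d.
    move=> i; have [|r] := @rat_in_itvoo R (tnth t i - d) (tnth t i + d).
      by rewrite ltrBlDr -addrA ltrDl addr_gt0.
    rewrite in_itv /= => /andP[r1 r2]; exists r.
    by rewrite ltr_norml; apply/andP; split; lra.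
  move=> /choice[f fd]; exists [tuple f i | i < n] => //=.
  set q := qr _; have wq : w (rowt t - q) <= d * S.
    rewrite /w /S mulr_sumr ler_sum // => i _; rewrite ler_wpM2r ?seminorm_ge0 //.
    by rewrite !mxE tnth_mktuple ltW.
  have pq : p q <= p (rowt t) + w (rowt t - q).
    rewrite (le_trans (seminorm_triangle q (rowt t) sp)) //.
    by rewrite lerD2l seminormB //; exact: seminorm_le_coord.
  have dS : 2 * (d * S) < c - p (rowt t).
    have <- : 2 * (d * (S + 1)) = c - p (rowt t).
      by rewrite /d; field; rewrite gt_eqF // ltr_wpDl.
    by rewrite ltr_pM2l // ltr_pM2l // ltrDl.
  by move: wq pq dS; move: (w _) => W; lra.
apply: countable_bigcupT_measurable => // q.
rewrite -[X in measurable X]setTI.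
suff mf : measurable_fun [set: n.-tuple Rm] (fun t => p (qr q) + w (rowt t - qr q)).
  rewrite (_ : mkset _ =
    (fun t : n.-tuple Rm => p (qr q) + w (rowt t - qr q)) @^-1` `]-oo, c[%classic).
    by apply: mf.
  by apply/seteqP; split => t /=; rewrite in_itv.
apply: measurable_funD => //; apply: measurable_sum => i; apply: measurable_funM => //.
apply: (measurableT_comp (@normr_measurable R setT)).
under eq_fun do rewrite mxE; apply: measurable_funD => //; exact: measurable_rowt.
Qed.

Lemma measurable_seminorm_le p s : seminorm p -> measurable_rV [set x | p x <= s].
Proof.
move=> sp; rewrite /measurable_rV -[X in measurable X]setTI.
rewrite (_ : mkset _ = (fun t : n.-tuple Rm => p (rowt t)) @^-1` `]-oo, s]%classic).
  by apply: measurable_seminorm.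
by apply/seteqP; split => t /=; rewrite in_itv.
Qed.

Definition vball p : \bar R := leb [set x | p x <= 1].

Lemma leb_seminorm_le p s : seminorm p -> 0 < s ->
  leb [set x | p x <= s] = ((s ^+ n)%:E * vball p)%E.
Proof.
move=> sp s0; have sV : s^-1 != 0 by rewrite invr_eq0 gt_eqF.
have uM : (s^-1)%:M \in @unitmx R n by rewrite unitmxE det_scalar unitfE expf_neq0.
have := scales_det uM (measurable_seminorm_le 1 sp).
rewrite det_scalar gtr0_norm ?exprn_gt0 ?invr_gt0 // exprVn invrK => <-; congr leb.
apply/seteqP; split => x /=; rewrite mul_mx_scalar sp.2 gtr0_norm ?invr_gt0 //.
  by move=> ps; rewrite ler_pdivrMl // mulr1.
by rewrite ler_pdivrMl // mulr1.
Qed.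

Lemma vballZ p a : seminorm p -> 0 < a -> vball (fun x => a * p x) = ((a ^- n)%:E * vball p)%E.
Proof.
move=> sp a0; rewrite -exprVn -leb_seminorm_le ?invr_gt0 //; congr leb.
by apply/seteqP; split => x /=; rewrite -ler_pdivlMl // mulr1.
Qed.

Definition exp_int p : \bar R := (\int[L]_t (expR (- p (rowt t)))%:E)%E.

Lemma measurable_exp_seminorm p : seminorm p ->
  measurable_fun [set: n.-tuple Rm] (fun t => expR (- p (rowt t))).
Proof.
move=> sp; apply: (measurableT_comp (@measurable_expR R)).
by apply: measurable_funN; exact: measurable_seminorm.
Qed.

(** Write exp (- p) as an integral of [cut_exp] and exchange the integrals: the sublevel set of
    radius x has volume x ^ n times that of the unit ball. *)
Lemma exp_intE p : seminorm p -> exp_int p = (gamma_int R n * vball p)%E.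
Proof.
move=> sp; pose f (z : n.-tuple Rm * Rm) : \bar R := (cut_exp (p (rowt z.1)) z.2)%:E.
have mf : measurable_fun [set: n.-tuple Rm * Rm] f.
  apply/measurable_EFinP; apply: measurable_cut_exp; last exact: measurable_snd.
  exact: (measurableT_comp (measurable_seminorm sp) measurable_fst).
have f0 z : (0 <= f z)%E by rewrite lee_fin cut_exp_ge0.
transitivity (\int[L]_t \int[lebesgue_measure]_x f (t, x))%E.
  by apply: eq_integral => t _; rewrite -(integral_cut_exp (seminorm_ge0 _ sp)).
rewrite (fubini_tonelli f mf f0).
transitivity (\int[lebesgue_measure]_x ((cut_exp 0 x * x ^+ n)%:E * vball p))%E.
  apply: eq_integral => x _.
  have [x0|x0] := leP x 0.
    rewrite {1}/cut_exp ltNge x0 /= mul0r mul0e integral0_eq // => t _.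
    by rewrite /f /cut_exp /= ltNge x0.
  rewrite (@integral_leb_cst _ _ [set x' | p x' <= x] _ (expR (- x))%:E).
  - by rewrite leb_seminorm_le // muleA -EFinM /cut_exp x0 ltW.
  - exact: measurable_seminorm_le.
  - by move=> t /= px; rewrite /f /cut_exp /= x0 px.
  - by move=> t /= px; rewrite /f /cut_exp /= x0 /=; case: ifP.
rewrite ge0_integralZr //.
- exact: measurable_cut_exp_pow.
- by move=> x _; rewrite lee_fin cut_exp0_pow_ge0.
Qed.

Lemma integral_shift (f : 'rV[R]_n -> R) (a : 'rV[R]_n) : (forall x, 0 <= f x) ->
  measurable_fun [set: n.-tuple Rm] (fun t => f (rowt t)) ->
  (\int[L]_t (f (rowt t + a))%:E = \int[L]_t (f (rowt t))%:E)%E.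
Proof.
move=> f0 mf; pose h (t : n.-tuple Rm) : n.-tuple Rm := tupr (rowt t + a).
have mh : measurable_fun [set: n.-tuple Rm] h.
  apply: measurable_tupr => i; under eq_fun do rewrite mxE.
  by apply: measurable_funD => //; exact: measurable_rowt.
transitivity (\int[pushforward L h]_t (f (rowt t))%:E)%E.
  rewrite (ge0_integral_pushforward mh L) //.
  - by apply: eq_integral => t _; rewrite /= tuprK.
  - exact/measurable_EFinP.
  - by move=> t _; rewrite lee_fin.
pose m : {measure set (n.-tuple Rm) -> \bar R} :=
  measure_function_pushforward__canonical__measure_function_Measure L mh.
apply: (@eq_measure_integral _ _ _ _ L m) => A mA _.
rewrite /m /= /pushforward -[LHS]/(leb [set x | A (tupr (x + a))]).
have mA' : measurable_rV [set x | A (tupr x)].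
  by rewrite /measurable_rV; under eq_set do rewrite /= rowtK.
by rewrite (leb_shift a mA') /leb; under eq_set do rewrite /= rowtK.
Qed.

Theorem exp_int_infconv p q : seminorm p -> seminorm q ->
  (exp_int (infconv p q) * exp_int (fun x => 2 * max_fun p q x)%R <=
   exp_int p * exp_int q)%E.
Proof.
move=> sp sq; set Q := infconv p q; set P := fun x => 2 * max_fun p q x.
have sQ : seminorm Q by exact: seminorm_infconv.
have sP : seminorm P by apply: seminormZ => //; exact: seminorm_max.
pose g (x z : 'rV[R]_n) := expR (- (p x + q (z - x))).
pose f (w : n.-tuple Rm * n.-tuple Rm) : \bar R := (g (rowt w.1) (rowt w.2))%:E.
have mq : measurable_fun [set: n.-tuple Rm * n.-tuple Rm]
    (fun w => q (rowt w.2 - rowt w.1)).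
  have md : measurable_fun [set: n.-tuple Rm * n.-tuple Rm]
      (fun w => tupr (rowt w.2 - rowt w.1)).
    apply: measurable_tupr => i; under eq_fun do rewrite mxE [X in _ + X]mxE.
    apply: measurable_funB.
      exact: (measurableT_comp (measurable_rowt i) measurable_snd).
    exact: (measurableT_comp (measurable_rowt i) measurable_fst).
  apply: eq_measurable_fun (measurableT_comp (measurable_seminorm sq) md) => w _.
  by rewrite /= tuprK.
have mf : measurable_fun [set: n.-tuple Rm * n.-tuple Rm] f.
  apply/measurable_EFinP/(measurableT_comp (@measurable_expR R)).
  apply: measurable_funN; apply: measurable_funD => //.
  exact: (measurableT_comp (measurable_seminorm sp) measurable_fst).
have f0 w : (0 <= f w)%E by rewrite lee_fin expR_ge0.
have E0 r t : (0 <= (expR (- r (rowt t : 'rV[R]_n)))%:E)%E by rewrite lee_fin expR_ge0.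
have mE r : seminorm r -> measurable_fun [set: n.-tuple Rm] (fun t => (expR (- r (rowt t)))%:E).
  by move=> sr; apply/measurable_EFinP; exact: measurable_exp_seminorm.
(* The substitution z = x + y, done as a translation of the inner integral for fixed x. *)
have -> : (exp_int p * exp_int q = \int[L]_t \int[L]_s f (t, s))%E.
  rewrite /exp_int -ge0_integralZr //; [|exact: mE|exact: integral_ge0].
  apply: eq_integral => t _; rewrite -ge0_integralZl_EFin ?expR_ge0 //; last exact: mE.
  have := @integral_shift (fun x => expR (- (p (rowt t) + q x))) (- rowt t).
  move=> ->; last 2 first.
  - by move=> x; exact: expR_ge0.
  - apply: (measurableT_comp (@measurable_expR R)); apply: measurable_funN.
    by apply: measurable_funD => //; exact: measurable_seminorm.
  by apply: eq_integral => s _; rewrite opprD expRD EFinM.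
rewrite (fubini_tonelli f mf f0) /exp_int -ge0_integralZr //; last 2 first.
- exact: mE.
- exact: integral_ge0.
have mG : measurable_fun [set: n.-tuple Rm] (fun s => \int[L]_t f (t, s))%E.
  exact: measurable_fun_fubini_tonelli_G.
apply: ge0_le_integral => //.
- by move=> t _; rewrite mule_ge0 // integral_ge0.
- by apply: emeasurable_funM => //; exact: mE.
move=> t _; rewrite -ge0_integralZl_EFin ?expR_ge0 //; last exact: mE.
(* It suffices to prove the inequality after multiplying the left side by any r in (0, 1). Writing r
   = exp (- e) gives the slack e allowed to the near-minimizer [x0]. *)
set z := rowt t; apply/lee_mul01Pr.
  by apply: integral_ge0 => s _; rewrite mule_ge0.
have mg (h : n.-tuple Rm -> 'rV[R]_n) :
    (forall i, measurable_fun [set: n.-tuple Rm] (fun s => h s 0 i)) ->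
    measurable_fun [set: n.-tuple Rm] (fun s => g (h s) z).
  move=> /measurable_tupr mh; apply/measurable_EFinP.
  have mhz : measurable_fun [set: n.-tuple Rm] (fun s => (tupr (h s), tupr z)).
    exact/measurable_fun_pair.
  apply: eq_measurable_fun (measurableT_comp mf mhz) => s _.
  by rewrite /f /= !tuprK.
move=> r /andP[r0 r1]; have e0 : 0 < - ln r by rewrite oppr_gt0 ln_lt0 // r0.
have [x0 xe] := infconv_adherent sp sq z e0.
rewrite -[leRHS](@integral_shift (fun x => g x z) x0); last 2 first.
- by move=> x; exact: expR_ge0.
- exact: (mg (@rowt R n) (@measurable_rowt R n)).
rewrite -ge0_integralZl_EFin ?(ltW r0) //; last by apply: measurable_funeM; exact: mE.
apply: ge0_le_integral => //.
- by move=> s _; rewrite !mule_ge0 // lee_fin ltW.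
- by do 2 apply: measurable_funeM; exact: mE.
- apply/measurable_EFinP; apply: (mg (fun s => rowt s + x0)) => i.
  by under eq_fun do rewrite mxE; apply: measurable_funD => //; exact: measurable_rowt.
move=> s _; rewrite -!EFinM lee_fin -[r in leLHS](lnK r0) -!expRD ler_expR.
set x := rowt s; rewrite /P.
have := sp.1 x x0; have := sq.1 (z - x0) (- x); rewrite seminormN // -addrA -opprD (addrC x0).
have : p x <= max_fun p q x by rewrite le_max lexx.
have : q x <= max_fun p q x by rewrite le_max lexx orbT.
by move: xe; rewrite -/Q; lra.
Qed.

End seminorm_integrals.

(** * The volume product of a dual pair *)

Section volume_product.
Context (R : realType) (n : nat).
Implicit Types (p q : 'rV[R]_n -> R).

Lemma vball_infconv p q : seminorm p -> seminorm q ->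
  ((2 ^- n)%:E * (vball (infconv p q) * vball (max_fun p q)) <= vball p * vball q)%E.
Proof.
move=> sp sq; have sM := seminorm_max sp sq.
have := exp_int_infconv sp sq; rewrite !exp_intE //; last 2 first.
- exact: seminormZ.
- exact: seminorm_infconv.
rewrite vballZ // muleACA [in leRHS]muleACA.
have g0 := gamma_int_gt0 R n.
have gfin : gamma_int R n \is a fin_num by rewrite ge0_fin_numE ?gamma_int_lty // ltW.
by rewrite lee_pmul2l ?fin_numM ?mule_gt0 // muleCA.
Qed.

Lemma le_vball p q : seminorm p -> seminorm q -> (forall x, p x <= q x) ->
  (vball q <= vball p)%E.
Proof.
move=> sp sq pq; apply: le_leb; [exact: measurable_seminorm_le..|].
by move=> x /=; apply: le_trans.
Qed.

Definition log2 (x : R) := ln x / ln 2.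

Lemma ln2_gt0 : 0 < ln 2 :> R.
Proof. by rewrite ln_gt0 // ltr1n. Qed.

Lemma log2_gt0 (x : R) : 1 < x -> 0 < log2 x.
Proof. by move=> x1; rewrite divr_gt0 ?ln2_gt0 // ln_gt0. Qed.

Lemma log2_sqr (x : R) : 0 < x -> log2 (x ^+ 2) = 2 * log2 x.
Proof. by move=> x0; rewrite /log2 lnXn // mulr2n; ring. Qed.

(** Equality holds at 2 and at 4, and the logarithm is concave in between. *)
Lemma le_2log2 (r : R) : 2 <= r -> r <= 4 -> r <= 2 * log2 r.
Proof.
move=> r2 r4; pose t := (4 - r) / 2.
have t0 : 0 <= t by rewrite divr_ge0 // subr_ge0.
have t1 : t <= 1 by rewrite ler_pdivrMr //; lra.
have := concave_ln (Itv01 t0 t1) (ltr0Sn R 1) (ltr0Sn R 3).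
rewrite !convRE /= /unstable.onem (_ : t * 2 + _ = r); last by rewrite /t; field.
have -> : ln (4%:R : R) = 2 * ln 2.
  rewrite (_ : 4%:R = 2 ^+ 2 :> R); last by rewrite -natrX.
  by rewrite lnXn // mulr_natl.
move=> tr; rewrite /log2 mulrA ler_pdivlMr ?ln2_gt0 //.
by have := ln2_gt0; move: tr; rewrite /t; move: (ln 2) (ln r) => l lr; lra.
Qed.

(* Each step replaces [r] by its square root and loses a factor [2 ^- n], which
   amounts to dividing [log2 r] by 2. *)
Lemma dual_pair_volume k p q (r : R) : seminorm p -> seminorm q -> dual_pair p q ->
  (forall x, p x <= enorm x) -> (forall x, q x <= r * enorm x) ->
  2 <= r -> r <= 4 ^+ (2 ^ k) ->
  (((2 * log2 r) ^- n)%:E * (vball (@enorm R n) * vball (@enorm R n)) <=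
   vball p * vball q)%E.
Proof.
have sE := @seminorm_enorm R n.
(* Direct comparison with Euclidean balls: the product is at least s ^- n times that of the
   Euclidean ball with itself, and s <= 2 log2 s. *)
have base p' q' (s : R) : seminorm p' -> seminorm q' ->
    (forall x, p' x <= enorm x) -> (forall x, q' x <= s * enorm x) ->
    2 <= s -> s <= 4 ->
  (((2 * log2 s) ^- n)%:E * (vball (@enorm R n) * vball (@enorm R n)) <=
   vball p' * vball q')%E.
  move=> sp sq pe qe s2 s4; have s0 : 0 < s by lra.
  have s1 : 1 < s by lra.
  have l0 : 0 < 2 * log2 s by rewrite mulr_gt0 // log2_gt0.
  apply: (@le_trans _ _ (vball (@enorm R n) * vball (fun x : 'rV_n => s * enorm x)%R)%E).
    rewrite vballZ // [leRHS]muleCA lee_wpmul2r ?mule_ge0 ?leb_ge0 //.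
    rewrite lee_fin lef_pV2 ?posrE ?exprn_gt0 //.
    by rewrite lerXn2r ?nnegrE ?(ltW s0) ?(ltW l0) ?le_2log2.
  apply: lee_pmul; rewrite ?leb_ge0 //; apply: le_vball => //.
  by apply: seminormZ => //; exact: ltW.
(* [k] bounds the number of square roots needed to bring [r] down to at most 4. *)
elim: k p q r => [|k IH] p q r sp sq dpq pe qe r2 rk.
  by apply: base => //; rewrite expn0 expr1 in rk.
have [r4|r4] := leP r 4; first exact: base.
pose s := Num.sqrt r; have r0 : 0 < r by lra.
have s2 : s ^+ 2 = r by rewrite sqr_sqrtr // ltW.
have s0 : 0 < s by rewrite sqrtr_gt0.
have les2 : 2 <= s by rewrite -(ler_pXn2r (ltn0Sn 1)) ?nnegrE ?(ltW s0) // s2; lra.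
pose p1 x := s * p x; pose q1 x := s^-1 * q x.
have sp1 : seminorm p1 by apply: seminormZ => //; exact: ltW.
have sq1 : seminorm q1 by apply: seminormZ => //; rewrite invr_ge0 ltW.
have dpq1 : dual_pair p1 q1 by exact: dual_pairZ.
have p1e x : p1 x <= s * enorm x by rewrite ler_pM2l.
have q1e x : q1 x <= s * enorm x.
  by rewrite ler_pdivrMl // mulrA -expr2 s2.
have -> : (vball p * vball q = vball p1 * vball q1)%E.
  rewrite !vballZ ?invr_gt0 // muleACA -EFinM exprVn invrK mulVf ?mul1e //.
  by rewrite expf_neq0 // gt_eqF.
apply: le_trans (vball_infconv sp1 sq1).
have {}IH := IH (infconv p1 q1) (max_fun p1 q1) s (seminorm_infconv sp1 sq1)
  (seminorm_max sp1 sq1) (dual_pair_step sp1 sq1 dpq1).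
have -> : ((2 * log2 r) ^- n = 2 ^- n * (2 * log2 s) ^- n)%R.
  by rewrite -s2 log2_sqr // exprMn invfM.
rewrite EFinM -muleA lee_wpmul2l ?lee_fin ?invr_ge0 ?exprn_ge0 //; apply: IH => //.
- by move=> x; exact: infconv_le_enorm.
- by move=> x; rewrite /max_fun ge_max p1e q1e.
- by rewrite -(ler_pXn2r (ltn0Sn 1)) ?nnegrE ?exprn_ge0 ?(ltW s0) // s2 -exprM mulnC -expnS.
Qed.

Lemma vball_mulmx p (A : 'M[R]_n) : seminorm p -> A \in unitmx ->
  vball (fun x => p (x *m A)) = ((`|\det A|^-1)%:E * vball p)%E.
Proof. by move=> sp uA; exact: (scales_det uA (measurable_seminorm_le 1 sp)). Qed.

Lemma dual_norm_mulmx p (A : 'M[R]_n) y : A \in unitmx ->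
  dual_norm (fun x => p (x *m A)) y = dual_norm p (y *m (invmx A)^T).
Proof.
move=> uA; congr sup; apply/seteqP; split => _ [x /= px <-].
  by exists (x *m A) => //; rewrite -dot_mulmxl mulmxK.
by exists (x *m invmx A) => /=; rewrite ?mulmxKV // dot_mulmxl.
Qed.

(** The dual norm transforms by the inverse transpose, so the two determinants cancel. This allows
    passing to John's position and from any ellipsoid to the Euclidean ball. *)
Lemma vball_dual_mulmx p c (A : 'M[R]_n) : seminorm p -> 0 < c ->
  (forall x, enorm x <= c * p x) -> A \in unitmx ->
  (vball (fun x => p (x *m A)) * vball (dual_norm (fun x => p (x *m A))) =
   vball p * vball (dual_norm p))%E.
Proof.
move=> sp c0 cp uA.
have -> : dual_norm (fun x => p (x *m A)) = (fun y => dual_norm p (y *m (invmx A)^T)).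
  by apply/funext => y; exact: dual_norm_mulmx.
rewrite !vball_mulmx ?unitmx_tr ?unitmx_inv //; last exact: seminorm_dual_norm cp.
rewrite muleACA -EFinM det_tr det_inv normfV invrK mulVf ?mul1e //.
by rewrite normr_eq0 -unitfE -unitmxE.
Qed.

Lemma dual_norm_enorm : dual_norm (@enorm R n) = @enorm R n.
Proof.
have e1 (x : 'rV[R]_n) : enorm x <= 1 * enorm x by rewrite mul1r.
have sE := @seminorm_enorm R n.
apply/funext => y; apply/eqP; rewrite eq_le; apply/andP; split.
  apply: (dual_norm_le sE ltr01 e1) => x x1; apply: le_trans (dot_le_enorm x y) _.
  by rewrite ler_piMl ?enorm_ge0.
have [y0|y0] := eqVneq (enorm y) 0.
  by rewrite y0 seminorm_ge0 //; exact: (seminorm_dual_norm sE ltr01 e1).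
have yp : 0 < enorm y by rewrite lt0r y0 enorm_ge0.
have := dot_le_dual_norm sE ltr01 e1 (x := (enorm y)^-1 *: y) y.
rewrite dotZl -sqr_enorm expr2 mulKf //; apply.
by rewrite sE.2 gtr0_norm ?invr_gt0 // mulVf.
Qed.

End volume_product.

(** * John's position *)

Section john.
Context (R : realType).

Lemma coord_le_enorm n (x : 'rV[R]_n) i : `|x 0 i| <= enorm x.
Proof.
rewrite -(ler_pXn2r (ltn0Sn 1)) ?nnegrE ?enorm_ge0 // sqr_enorm dotE.
rewrite real_normK ?num_real // (bigD1 i) //= -expr2 lerDl.
by apply: sumr_ge0 => j _; rewrite -expr2 sqr_ge0.
Qed.

Lemma seminorm_le_enorm n (p : 'rV[R]_n -> R) : seminorm p ->
  exists2 M, 0 < M & forall x, p x <= M * enorm x.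
Proof.
move=> sp; exists (\sum_i p (delta_mx 0 i) + 1) => [|x].
  by rewrite ltr_wpDl // sumr_ge0 // => i _; exact: seminorm_ge0.
apply: le_trans (seminorm_le_coord x sp) _.
apply: (@le_trans _ _ (\sum_i p (delta_mx 0 i) * enorm x)).
  by apply: ler_sum => i _; rewrite mulrC ler_wpM2l ?seminorm_ge0 // coord_le_enorm.
by rewrite -mulr_suml ler_wpM2r ?enorm_ge0 // lerDl.
Qed.

Lemma continuous_seminorm n (p : 'rV[R]_n -> R) : seminorm p -> continuous p.
Proof.
move=> sp /= x B /= /(nbhs_ballP (p x)) [e /= e0 eB].
pose M := \sum_i p (delta_mx 0 i : 'rV[R]_n) + 1.
have M0 : 0 < M.
  by rewrite ltr_wpDl // sumr_ge0 // => i _; exact: seminorm_ge0.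
apply/nbhs_ballP; exists (e / M) => /= [|y [_ xy]]; first by rewrite divr_gt0.
have pB (u v : 'rV[R]_n) : (forall i, `|u 0 i - v 0 i| < e / M) -> p u - p v < e.
  move=> uv; have := seminorm_triangle u v sp; rewrite -lerBlDl => /le_lt_trans; apply.
  apply: le_lt_trans (seminorm_le_coord (u - v) sp) _.
  apply: (@le_lt_trans _ _ (e / M * \sum_i p (delta_mx 0 i))).
    rewrite mulr_sumr; apply: ler_sum => i _.
    by rewrite ler_wpM2r ?seminorm_ge0 // !mxE ltW.
  by rewrite mulrAC ltr_pdivrMr // ltr_pM2l // ltrDl.
apply: eB; rewrite /ball /= ltr_norml; apply/andP; split; last by apply: pB => i; exact: xy.
by rewrite ltrNl opprB; apply: pB => i; rewrite distrC; exact: xy.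
Qed.

Lemma continuous_det n : continuous (fun a : 'rV[R]_(n * n) => \det (vec_mx a)).
Proof.
apply: continuous_big => [|s _]; first exact: add_continuous.
have cP : continuous (fun a : 'rV[R]_(n * n) => \prod_i vec_mx a i (s i)).
  apply: continuous_big => [|i _]; first exact: mul_continuous.
  by under eq_fun do rewrite mxE; exact: coord_continuous.
by move=> a; apply: (@continuousM _ _ (fun=> _)); [exact: cst_continuous | exact: cP].
Qed.

(** [A] maximizes the determinant over the compact set of matrices that send the Euclidean ball into
    the body. A point of the transformed body farther than sqrt n would let [john_stretch] increase
    it. *)
Theorem john_position n (p : 'rV[R]_n -> R) (c : R) : seminorm p -> 0 < c ->
  (forall x, enorm x <= c * p x) ->
  exists A : 'M[R]_n, [/\ A \in unitmx, forall x, p (x *m A) <= enorm x &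
    forall x, p (x *m A) <= 1 -> dot x x <= n%:R].
Proof.
move=> sp c0 cp; pose S := [set a : 'rV[R]_(n * n) | forall v, p (v *m vec_mx a) <= enorm v].
have cS : compact S.
  apply: bounded_closed_compact.
    exists c; split; first exact: num_real.
    move=> M cM a Sa /=; rewrite [leLHS]/Num.norm /= mx_normrE.
    apply/bigmax_leP; split=> [|[i j] _ /=]; first by rewrite ltW // (lt_trans c0).
    rewrite (ord1 i); case/mxvec_indexP: j => k l.
    (* Each row is the image of a unit basis vector, so it has [p] at most 1 and Euclidean norm at
       most [c]. *)
    rewrite (_ : a 0 _ = row k (vec_mx a) 0 l); last by rewrite !mxE.
    rewrite (le_trans (coord_le_enorm _ l)) // (le_trans (cp _)) //.
    rewrite (le_trans _ (ltW cM)) // ler_piMr ?(ltW c0) // rowE (le_trans (Sa _)) //.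
    rewrite -(ler_pXn2r (ltn0Sn 1)) ?nnegrE ?enorm_ge0 // sqr_enorm /dot.
    by rewrite trmx_delta mul_delta_mx mxE !eqxx expr1n.
  rewrite (_ : S = \bigcap_(v in [set: 'rV[R]_n])
      ((fun a => p (v *m vec_mx a)) @^-1` [set x | x <= enorm v])).
    apply: closed_bigI => v _; apply: preimage_closed; last exact: closed_le.
    move=> a _; apply: continuous_seminorm; split=> [x y|b x].
      by rewrite linearD mulmxDr sp.1.
    by rewrite linearZ /= -scalemxAr sp.2.
  by apply/seteqP; split => a /= Sa v => [_|]; exact: Sa.
have [M M0 pM] := seminorm_le_enorm sp.
(* A small multiple of the identity is admissible; its positive determinant makes the maximizer
   invertible. *)
have S1 : S (mxvec (M^-1)%:M).
  move=> v /=; rewrite mxvecK mul_mx_scalar sp.2 gtr0_norm ?invr_gt0 //.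
  by rewrite ler_pdivrMl.
have [a aS amax] := EVT_max_rV (ex_intro _ _ S1) cS
  (continuous_subspaceT (@continuous_det n)).
rewrite in_setE in aS.
have da : 0 < \det (vec_mx a).
  apply: lt_le_trans (amax _ _); last by rewrite in_setE; exact: S1.
  by rewrite mxvecK det_scalar exprn_gt0 // invr_gt0.
exists (vec_mx a); split=> // [|x px].
  by rewrite unitmxE unitfE gt_eqF.
rewrite leNgt; apply/negP => nx.
have [T [dT pT]] := john_stretch (seminorm_mulmx _ sp) aS px nx.
have : \det (vec_mx (mxvec (T *m vec_mx a))) <= \det (vec_mx a).
  by apply: amax; rewrite in_setE => v; rewrite mxvecK mulmxA.
by rewrite mxvecK det_mulmx ger_pMl // leNgt dT.
Qed.

Theorem norm_volume n (p : 'rV[R]_n -> R) (c : R) : (4 <= n)%N ->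
  seminorm p -> 0 < c -> (forall x, enorm x <= c * p x) ->
  (((log2 n%:R) ^- n)%:E * (vball (@enorm R n) * vball (@enorm R n)) <=
   vball p * vball (dual_norm p))%E.
Proof.
move=> n4 sp c0 cp; have [A [uA pA Ap]] := john_position sp c0 cp.
pose q x := p (x *m A); have sq : seminorm q by exact: seminorm_mulmx.
pose r : R := Num.sqrt n%:R.
have r2 : r ^+ 2 = n%:R by rewrite sqr_sqrtr.
have les2 : 2 <= r.
  by rewrite -(ler_pXn2r (ltn0Sn 1)) ?nnegrE ?sqrtr_ge0 // r2 -natrX ler_nat.
have r0 : 0 < r by lra.
have er x : q x <= 1 -> enorm x <= r.
  move=> /Ap; rewrite -sqr_enorm -r2 ler_pXn2r ?nnegrE ?enorm_ge0 //.
  exact: ltW.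
have rq x : enorm x <= r * q x.
  have [q0|q0] := eqVneq (q x) 0.
    rewrite q0 mulr0 leNgt; apply/negP => ex.
    (* If [q] vanished at a nonzero [x], the multiple of [x] of norm 2 r would lie in the unit ball
       of [q], whose points have norm at most [r]. *)
    have := er ((2 * r / enorm x) *: x); rewrite sq.2 q0 mulr0 ler01 => /(_ isT).
    rewrite (seminorm_enorm R n).2 gtr0_norm ?divr_gt0 ?mulr_gt0 // mulfVK ?gt_eqF //.
    by lra.
  have qp : 0 < q x by rewrite lt0r q0 seminorm_ge0.
  have := er ((q x)^-1 *: x); rewrite sq.2 (seminorm_enorm R n).2.
  by rewrite gtr0_norm ?invr_gt0 // mulVf // lexx mulrC ler_pdivrMr //; apply.
rewrite -(vball_dual_mulmx sp c0 cp uA) -/q -r2 log2_sqr //.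
apply: (@dual_pair_volume _ _ n _ _ r) => //.
- exact: seminorm_dual_norm rq.
- exact: dual_pair_dual_norm rq.
- move=> y; apply: (dual_norm_le sq r0 rq) => x /er xr.
  by apply: le_trans (dot_le_enorm x y) _; rewrite ler_wpM2r ?enorm_ge0.
(* [n] serves as the number of steps: r <= r ^ 2 = n <= 2 ^ n <= 4 ^ n <= 4 ^ (2 ^ n). *)
- apply: (@le_trans _ _ (r ^+ 2)); first by rewrite expr2 ler_peMr ?(ltW r0) //; lra.
  rewrite r2 -natrX ler_nat; apply: (@leq_trans (2 ^ n)); first exact/ltnW/ltn_expl.
  by apply: (@leq_trans (4 ^ n)); [rewrite leq_exp2r // (leq_trans _ n4) |
    rewrite leq_exp2l // ltnW // ltn_expl].
Qed.

End john.

(** * Bases and volume forms *)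

Section volume_forms.
Context (R : realType) (V : vectType R) (n : nat).
Implicit Types (w : ('I_n -> V) -> R) (v b : 'I_n -> V).

(** Polarization: put v i + v j in both places and expand. The total and the two diagonal terms
    vanish, so the remaining two terms are opposite. *)
Lemma volume_form_tperm_eq0 w v (i j : 'I_n) : volume_form w ->
  w v = 0 -> w (fun k => v (tperm i j k)) = 0.
Proof.
move=> [wl wa _]; have [<-|ij] := eqVneq i j.
  by under eq_fun do rewrite tperm1 perm1.
pose u x y : 'I_n -> V := dfwith (dfwith v i x) j y.
have uxx x : w (u x x) = 0.
  apply: (wa _ _ _ ij); rewrite /u dfwithin dfwithout 1?eq_sym // dfwithin //.
have uC x y : u x y = dfwith (dfwith v j y) i x.
  apply/funext => k; rewrite /u; case: dfwithP => [|k' jk]; first by rewrite dfwithout // dfwithin.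
  by have [<-|ik] := eqVneq i k'; rewrite ?dfwithin // !dfwithout.
have uDr x y z : w (u x (y + z)) = w (u x y) + w (u x z).
  by rewrite -[y]scale1r /u wl mul1r scale1r.
have uDl x y z : w (u (x + y) z) = w (u x z) + w (u y z).
  by rewrite -[x]scale1r !uC wl mul1r scale1r.
have vE : v = u (v i) (v j).
  apply/funext => k; rewrite /u; case: dfwithP => // k' jk.
  by case: dfwithP.
have -> : (fun k => v (tperm i j k)) = u (v j) (v i).
  apply/funext => k; rewrite /u; case: dfwithP => [|k' jk]; first by rewrite tpermR.
  by have [<-|ik] := eqVneq i k'; rewrite ?dfwithin ?tpermL // dfwithout // tpermD.
rewrite [in w v = 0]vE => uij; have := uxx (v i + v j).
by rewrite uDl !uDr !uxx uij add0r addr0 add0r.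
Qed.

(** If [w b] were 0, then [w] would vanish on all permutations of [b], on all families drawn from
    [b] (a repetition kills it), and by multilinearity everywhere. *)
Lemma volume_form_basis w b : volume_form w ->
  (forall x, exists c : 'I_n -> R, x = \sum_i c i *: b i) -> w b != 0.
Proof.
move=> hw bspan; have [wl wa [v0 wv0]] := hw; apply/negP => /eqP wb0.
move/negP: wv0; apply; apply/eqP.
have wperm (s : {perm 'I_n}) : w (fun k => b (s k)) = 0.
  have [ts -> _] := prod_tpermP s; elim: ts => [|t ts IH].
    by rewrite big_nil; under eq_fun do rewrite perm1.
  rewrite big_cons; under eq_fun do rewrite permM.
  exact: (volume_form_tperm_eq0 (v := fun k => b _) t.1 t.2 hw IH).
have wfun (phi : 'I_n -> 'I_n) : w (fun k => b (phi k)) = 0.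
  have [/injectiveP phi_inj|/injectivePn[i [j ij phiij]]] := boolP (injectiveb phi).
    rewrite -(wperm (perm phi_inj)); congr w.
    by apply/funext => k; rewrite permE.
  by apply: (wa _ _ _ ij); rewrite phiij.
(* Induction on the number [k] of leading arguments that are arbitrary, the others being taken from
   [b]. *)
suff wk k v : (forall i : 'I_n, (k <= i)%N -> exists j, v i = b j) -> w v = 0.
  by apply: (wk n) => i; rewrite leqNgt ltn_ord.
elim: k v => [|k IH] v vb.
  have /choice[phi vphi] : forall i : 'I_n, exists j, v i = b j by move=> i; exact: vb.
  by rewrite (_ : v = fun k => b (phi k)) //; apply/funext.
have [nk|kn] := leqP n k.
  by apply: IH => i ki; exfalso; have := ltn_ord i; rewrite ltnNge (leq_trans nk ki).
pose i0 := Ordinal kn; have vE : v = dfwith v i0 (v i0).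
  by apply/funext => i; case: dfwithP.
have w0 : w (dfwith v i0 0) = 0.
  have := wl v i0 1 0 0; rewrite scale1r addr0 mul1r => /eqP.
  by rewrite -subr_eq0 opprD addNKr oppr_eq0 => /eqP.
have [c vc] := bspan (v i0); rewrite vE vc.
elim/big_rec : _ => [//|j x _ wx]; rewrite wl wx addr0 [X in _ * X]IH ?mulr0 // => i ki.
case: dfwithP ki => [_|i' i0i ki]; first by exists j.
by apply: vb; rewrite ltn_neqAle ki andbT; apply: contra i0i => /eqP ki'; apply/eqP/val_inj.
Qed.

End volume_forms.

(** * Factorization of positive-definite symmetric matrices *)

Section cholesky.
Context (R : realType).

Lemma dot_row_mx n (a c : R) (x y : 'rV[R]_n) :
  dot (row_mx (a%:M : 'M[R]_1) x) (row_mx (c%:M : 'M[R]_1) y) = a * c + dot x y.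
Proof.
rewrite /dot tr_row_mx mul_row_col mxE tr_scalar_mx -scalar_mxM.
by rewrite [X in X + _]mxE eqxx mulr1n.
Qed.

Lemma cholesky n (G : 'M[R]_n) : G^T = G -> (forall x, x != 0 -> 0 < dot (x *m G) x) ->
  exists T : 'M[R]_n, G = T *m T^T.
Proof.
elim: n G => [|n IH] G symG posG; first by exists 0; apply/matrixP => -[].
move: symG posG; rewrite -[n.+1]/(1 + n)%N in G *; rewrite -[G]submxK => symG posG.
move: (ulsubmx _) (ursubmx _) (dlsubmx _) (drsubmx _) symG posG => a r c G' symG posG.
move: symG; rewrite tr_block_mx => /eq_block_mx[_ _ cr symG'].
have {}cr : c = r^T by rewrite -cr.
rewrite {c}cr in posG *; rewrite [a]mx11_scalar in posG *; move: (a 0 0) posG => {}a posG.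
have dotG x0 (x' : 'rV[R]_n) : let x := row_mx (x0%:M : 'M[R]_1) x' in
    dot (x *m block_mx a%:M r r^T G') x =
    x0 * (x0 * a) + 2 * (x0 * dot r x') + dot (x' *m G') x'.
  rewrite /= mul_row_block -scalar_mxM mul_scalar_mx [x' *m r^T]mx11_scalar -/(dot x' r).
  by rewrite -raddfD dot_row_mx dotDl dotZl (dotC x' r); ring.
have a0 : 0 < a.
  have dot0 (y : 'rV[R]_n) : dot y 0 = 0 by rewrite dotC dot0l.
  have := posG (row_mx (1%:M : 'M[R]_1) 0).
  rewrite dotG mul0mx !dot0 !(mulr0, addr0, mul1r); apply.
  apply: contra_neq (oner_neq0 R) => /rowP/(_ (lshift n 0)).
  by rewrite row_mxEl !mxE eqxx.
pose S := G' - a^-1 *: (r^T *m r).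
have [||T' ST] := IH S.
- by rewrite /S linearB linearZ /= trmx_mul trmxK symG'.
(* This first coordinate minimizes the quadratic form for fixed [x'], and the minimum is the form of
   the Schur complement [S] at [x']. *)
- move=> x' x'0; have := posG (row_mx ((- a^-1 * dot r x')%:M : 'M[R]_1) x').
  have xn0 : row_mx ((- a^-1 * dot r x')%:M : 'M[R]_1) x' != 0.
    by apply: contra_neq x'0 => /(congr1 rsubmx); rewrite row_mxKr linear0.
  move=> /(_ xn0); rewrite dotG; congr (_ < _).
  rewrite mulmxBr dotDl dotNl -scalemxAr dotZl mulmxA [x' *m r^T]mx11_scalar -/(dot x' r).
  by rewrite mul_scalar_mx dotZl (dotC x' r); field; rewrite gt_eqF.
exists (block_mx (Num.sqrt a)%:M 0 ((Num.sqrt a)^-1 *: r^T) T').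
have sa : Num.sqrt a != 0 by rewrite gt_eqF // sqrtr_gt0.
rewrite tr_block_mx mulmx_block tr_scalar_mx trmx0 linearZ /= trmxK.
rewrite !(mulmx0, mul0mx, addr0) -scalar_mxM -expr2 sqr_sqrtr ?ltW // mul_scalar_mx.
rewrite mul_mx_scalar !scalerA mulfV // !scale1r -ST /S -scalemxAl -scalemxAr scalerA.
by rewrite -invfM -expr2 sqr_sqrtr ?ltW // addrC subrK.
Qed.

End cholesky.

(** * Gauges *)

Section gauge.
Context (R : realType) (n : nat) (C : set 'rV[R]_n) (d c : R).
Hypotheses (cvxC : forall x y a, C x -> C y -> 0 <= a <= 1 -> C (a *: x + (1 - a) *: y))
  (symC : forall x, C x -> C (- x)) (clC : closed C)
  (d0 : 0 < d) (dC : forall x, enorm x < d -> C x)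
  (c0 : 0 < c) (Cc : forall x, C x -> enorm x <= c).

Definition gauge x : R := inf [set t | 0 < t /\ C (t^-1 *: x)].

Let gaugeS x : has_inf [set t | 0 < t /\ C (t^-1 *: x)].
Proof.
split; last by exists 0 => t [t0 _]; exact: ltW.
have t0 : 0 < enorm x / d + 1 by rewrite ltr_wpDl // divr_ge0 ?enorm_ge0 // ltW.
exists (enorm x / d + 1); split => //; apply: dC.
rewrite (seminorm_enorm R n).2 gtr0_norm ?invr_gt0 // ltr_pdivrMl // mulrDl mul1r.
by rewrite divfK ?gt_eqF // ltrDl.
Qed.

Let gauge_le x t : 0 < t -> C (t^-1 *: x) -> gauge x <= t.
Proof. by move=> t0 Ct; apply: ge_inf; [exact: (gaugeS x).2 | ]. Qed.

Let gauge_lt x s : gauge x < s -> 0 < s /\ C (s^-1 *: x).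
Proof.
move=> xs; have [|t [t0 Ct] ts] := @inf_lt R [set t | 0 < t /\ C (t^-1 *: x)] s _ xs.
  exact: (gaugeS x).1.
have s0 := lt_trans t0 ts; split => //.
have C0 : C 0 by apply: dC; rewrite seminorm0 //; exact: seminorm_enorm.
have -> : s^-1 *: x = (t / s) *: (t^-1 *: x) + (1 - t / s) *: 0.
  by rewrite scaler0 addr0 scalerA; congr (_ *: _); field; rewrite !gt_eqF.
by apply: cvxC => //; rewrite divr_ge0 ?(ltW t0) ?(ltW s0) //= ler_pdivrMr // mul1r ltW.
Qed.

Let gauge_ge0 x : 0 <= gauge x.
Proof. by apply: lb_le_inf; [exact: (gaugeS x).1 | move=> t [t0 _]; exact: ltW]. Qed.

Lemma seminorm_gauge : seminorm gauge.
Proof.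
have gZ a x : a != 0 -> gauge (a *: x) <= `|a| * gauge x.
  move=> a0; have na : 0 < `|a| by rewrite normr_gt0.
  rewrite -ler_pdivrMl //; apply: lb_le_inf; first exact: (gaugeS x).1.
  move=> t [t0 Ct]; rewrite ler_pdivrMl //; apply: gauge_le; first exact: mulr_gt0.
  have -> : (`|a| * t)^-1 *: (a *: x) = (a / `|a|) *: (t^-1 *: x).
    by rewrite !scalerA; congr (_ *: _); field; rewrite !gt_eqF.
  have [a1|a1] := ltrP 0 a; first by rewrite gtr0_norm // divff // scale1r.
  by rewrite ler0_norm // invrN mulrN divff // scaleN1r; exact: symC.
split=> [x y|a x].
  apply/ler_addgt0Pr => e e0.
  have e20 : 0 < e / 2 by rewrite divr_gt0.
  have [s s0 [Cs se]] : exists2 s, 0 < s & C (s^-1 *: x) /\ s <= gauge x + e / 2.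
    by exists (gauge x + e / 2); have [] := @gauge_lt x (gauge x + e / 2); rewrite ?ltrDl.
  have [t t0 [Ct te]] : exists2 t, 0 < t & C (t^-1 *: y) /\ t <= gauge y + e / 2.
    by exists (gauge y + e / 2); have [] := @gauge_lt y (gauge y + e / 2); rewrite ?ltrDl.
  apply: (@le_trans _ _ (s + t)); last by lra.
  have st0 : 0 < s + t by rewrite addr_gt0.
  apply: gauge_le => //.
  have -> : (s + t)^-1 *: (x + y) =
      (s / (s + t)) *: (s^-1 *: x) + (1 - s / (s + t)) *: (t^-1 *: y).
    by rewrite !scalerA scalerDr; congr (_ *: _ + _ *: _); field; rewrite !gt_eqF.
  apply: cvxC => //; rewrite divr_ge0 ?(ltW s0) ?(ltW st0) //= ler_pdivrMr // mul1r.
  by rewrite lerDl ltW.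
have [->|a0] := eqVneq a 0.
  rewrite scale0r normr0 mul0r; apply/eqP; rewrite eq_le gauge_ge0 andbT.
  apply/ler_addgt0Pr => e e0; rewrite add0r; apply: gauge_le => //.
  by rewrite scaler0; apply: dC; rewrite seminorm0 //; exact: seminorm_enorm.
apply/eqP; rewrite eq_le gZ //= -ler_pdivlMl ?normr_gt0 // -normfV.
by have := gZ a^-1 (a *: x); rewrite scalerK // invr_eq0; apply.
Qed.

Lemma enorm_le_gauge x : enorm x <= c * gauge x.
Proof.
rewrite -ler_pdivrMl //; apply: lb_le_inf; first exact: (gaugeS x).1.
move=> t [t0 /Cc]; rewrite (seminorm_enorm R n).2 gtr0_norm ?invr_gt0 //.
by rewrite !ler_pdivrMl // mulrC.
Qed.

(** For the converse, [s^-1 *: x] lies in [C] for every s > 1 and tends to [x] as s decreases to 1,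
    while [C] is closed. *)
Lemma gauge_le1 x : C x <-> gauge x <= 1.
Proof.
split=> [Cx|px]; first by apply: gauge_le => //; rewrite invr1 scale1r.
apply: clC => B /nbhs_ballP[e /= e0 eB].
pose M := `|x| + 1; have M0 : 0 < M by rewrite ltr_wpDl.
pose s := 1 + e / M; have s1 : 1 < s by rewrite ltrDl divr_gt0.
have s0 : 0 < s by lra.
have [_ Cs] : 0 < s /\ C (s^-1 *: x) by apply: gauge_lt; exact: le_lt_trans s1.
exists (s^-1 *: x); split => //; apply: eB; rewrite -ball_normE /=.
rewrite -{1}[x]scale1r -scalerBl normrZ.
have -> : 1 - s^-1 = e / M / s.
  have -> : e / M = s - 1 by rewrite /s addrC addKr.
  by rewrite mulrBl mul1r divff // gt_eqF.
rewrite gtr0_norm ?divr_gt0 //; apply: (@le_lt_trans _ _ (e / M * `|x|)).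
  by rewrite ler_wpM2r // ler_piMr ?invf_le1 ?(ltW s1) // ltW // divr_gt0.
by rewrite mulrAC ltr_pdivrMr // ltr_pM2l // ltrDl.
Qed.



End gauge.

(** * Coordinates *)

Section coordinates.
Context (R : realType).

Definition combine (W : vectType R) n (x : 'rV[R]_n) : W :=
  \sum_(i < n) x 0 i *: std_basis W i.

Lemma combine_eq0 (W : vectType R) n (x : 'rV[R]_n) : \dim {:W} = n ->
  combine W x = 0 -> x = 0.
Proof.
move=> dW; case: n / dW x => x x0; apply/rowP => i.
rewrite -(coord_sum_free (X := vbasis {:W}) (x 0) i (basis_free (vbasisP _))).
by rewrite -[X in coord _ _ X]/(combine W x) x0 linear0 mxE.
Qed.

Context (V : vectType R).
Local Notation n := (\dim {:V}).
Local Notation dualV := 'Hom(V, R^o).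

Definition coords (v : V) : 'rV[R]_n := \row_i coord (vbasis {:V}) i v.

Lemma coordsK : cancel coords (@combine V n).
Proof.
move=> v; rewrite [RHS](coord_vbasis (memvf v)).
by apply: eq_bigr => i _; rewrite mxE.
Qed.

Lemma combineK : cancel (@combine V n) coords.
Proof.
move=> x; apply/rowP => i; rewrite mxE.
exact: (coord_sum_free (X := vbasis {:V}) (x 0) i (basis_free (vbasisP _))).
Qed.

Lemma combineN x : combine V (- x : 'rV[R]_n) = - combine V x.
Proof. by rewrite /combine -sumrN; apply: eq_bigr => i _; rewrite mxE scaleNr. Qed.

Lemma combineZD a b (x y : 'rV[R]_n) :
  combine V (a *: x + b *: y) = a *: combine V x + b *: combine V y.
Proof.
rewrite /combine !scaler_sumr -big_split; apply: eq_bigr => i _ /=.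
by rewrite !mxE scalerDl !scalerA.
Qed.

(** The standard bases of [V] and of its dual need not be dual to each other; the determinant of
    this matrix measures the defect and is the numerator of [dual_form] on the standard basis. *)
Definition pairing_mx : 'M[R]_n :=
  \matrix_(i < n, j < n) ((std_basis dualV i) (std_basis V j) : R).

Lemma combine_dual (x y : 'rV[R]_n) :
  combine dualV y (combine V x) = dot (y *m pairing_mx) x.
Proof.
rewrite dotE /combine sum_lfunE.
under eq_bigr do rewrite scale_lfunE linear_sum /= scaler_sumr.
rewrite exchange_big; apply: eq_bigr => j _; rewrite mxE mulr_suml.
apply: eq_bigr => i _; rewrite linearZ /= mxE /GRing.scale /=; ring.
Qed.

Lemma pairing_mx_unit : pairing_mx \in unitmx.
Proof.
rewrite -row_free_unit; apply: inj_row_free => y yM.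
apply: (@combine_eq0 dualV); first by rewrite !dimvf /dim /= muln1.
apply/lfunP => v; by rewrite -[v]coordsK combine_dual yM lfunE /= dot0l.
Qed.

Lemma volE (W : vectType R) m (w : ('I_m -> W) -> R) (A : set W) :
  vol w A = (`|w (@std_basis R W m)|%:E * leb [set x : 'rV[R]_m | A (combine W x)])%E.
Proof.
have cE (t : m.-tuple R) : combine W (rowt t) = \sum_(i < m) tnth t i *: std_basis W i.
  by apply: eq_bigr => i _; rewrite mxE.
rewrite /vol /leb; congr (_ * lebesgue_tuple R m _)%E; apply/seteqP.
by split => t /=; rewrite cE.
Qed.

(** With w b the value of [w] on the standard basis and P = [pairing_mx], the normalizations are |w
    b| for [V] and |det P / w b| for the dual, and the coordinates of the polar contribute |det
    P|^-1: they multiply to 1. *)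
Lemma volume_product (w : ('I_n -> V) -> R) (K : set V) (p : 'rV[R]_n -> R) c :
  volume_form w -> seminorm p -> 0 < c -> (forall x, enorm x <= c * p x) ->
  (forall x, K (combine V x) <-> p x <= 1) ->
  (vol w K * vol (dual_form w) (polar K) = vball p * vball (dual_norm p))%E.
Proof.
move=> hw sp c0 cp Kp; rewrite !volE muleACA -EFinM.
have wb : w (@std_basis R V n) != 0.
  apply: (volume_form_basis hw) => v; exists (coords v 0).
  exact/esym/coordsK.
have uM := pairing_mx_unit; have dM : \det pairing_mx != 0 by rewrite -unitfE -unitmxE.
have sd := seminorm_dual_norm sp c0 cp.
have -> : leb [set y : 'rV[R]_n | polar K (combine dualV y)] =
    vball (fun y => dual_norm p (y *m pairing_mx)).
  congr leb; apply/seteqP; split => y /= Ky.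
    apply: (dual_norm_le sp c0 cp) => x px; rewrite dotC -combine_dual.
    have /Ky : (combine dualV y @` K) (combine dualV y (combine V x)).
      by exists (combine V x) => //; apply/Kp.
    by rewrite /= in_itv /= => /andP[].
  move=> _ [v Kv <-]; rewrite -(coordsK v) in Kv *; move/Kp: Kv => pv.
  rewrite combine_dual /= in_itv /= lerNl dotC -dotNl; apply/andP; split.
    by apply: le_trans Ky; apply: (dot_le_dual_norm sp c0 cp); rewrite seminormN.
  by apply: le_trans Ky; exact: (dot_le_dual_norm sp c0 cp).
rewrite (vball_mulmx sd uM) (_ : leb _ = vball p); last first.
  by congr leb; apply/seteqP; split => x /= /Kp.
rewrite [X in (_ * X)%E = _]muleCA [LHS]muleA -[X in (X * _)%E = _]EFinM /dual_form -/pairing_mx.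
rewrite normrM normfV.
rewrite (_ : `|_| * _ * _ = 1) ?mul1e //.
by field; rewrite !normr_eq0 wb dM.
Qed.

Lemma convex_body_norm (K : set V) : convex_body K -> symmetric_set K ->
  exists p c, [/\ seminorm p, 0 < c, forall x : 'rV[R]_n, enorm x <= c * p x &
    forall x, K (combine V x) <-> p x <= 1].
Proof.
move=> [cK vK iK] symK; pose C : set 'rV[R]_n := [set x | K (combine V x)].
have CE : C = coords @` K.
  apply/seteqP; split => [x Cx|_ [v Kv <-]]; last by rewrite /C /= coordsK.
  by exists (combine V x) => //; rewrite combineK.
have cC : compact C.
  (* [coords] is the very map whose initial topology is [vect_topology], hence continuous. *)
  rewrite CE; apply: (@continuous_compact (vect_topology V)) => //.
  by apply: continuous_subspaceT; exact: initial_continuous.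
have symC x : C x -> C (- x).
  by rewrite /C /= combineN -{2}symK => Kx; exists (combine V x).
have cvxC x y a : C x -> C y -> 0 <= a <= 1 -> C (a *: x + (1 - a) *: y).
  rewrite /C /= => Kx Ky /andP[a0 a1]; rewrite combineZD.
  by have := vK (combine V x) (combine V y) (Itv01 a0 a1); rewrite !in_setE => /(_ Kx Ky).
have [c c0 Cc] : exists2 c, 0 < c & forall x, C x -> enorm x <= c.
  have [B [_ CB]] := compact_bounded cC.
  pose M := \sum_i enorm (delta_mx 0 i : 'rV[R]_n).
  have M0 : 0 <= M by apply: sumr_ge0 => i _; exact: enorm_ge0.
  exists ((`|B| + 1) * M + 1) => [|x Cx].
    by rewrite ltr_wpDl // mulr_ge0 // addr_ge0.
  have xB : `|x| <= `|B| + 1 by apply: CB => //; rewrite ltr_pwDr // ler_norm.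
  apply: le_trans (seminorm_le_coord x (@seminorm_enorm R n)) _.
  apply: (@le_trans _ _ ((`|B| + 1) * M)); last by rewrite lerDl.
  rewrite /M mulr_sumr; apply: ler_sum => i _; rewrite ler_wpM2r ?enorm_ge0 //.
  apply: le_trans xB; rewrite [leRHS]/Num.norm /= mx_normrE.
  by apply/bigmax_geP; right; exists (ord0, i).
have [d d0 dC] : exists2 d, 0 < d & forall x, enorm x < d -> C x.
  have [v] := iK; rewrite /interior /= nbhsE /= => -[Y [[U oU UY] Yv] YK].
  rewrite -UY /= in Yv; have := open_nbhs_nbhs (conj oU Yv).
  move=> /nbhs_ballP[e /= e0 eU].
  have ballC x : enorm x < e -> C (coords v + x).
    move=> xe; rewrite /C /=; apply: YK; rewrite -UY /= -/(coords _) combineK.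
    apply: eU; split => // i j; rewrite (ord1 i) /ball /= !mxE opprD addNKr normrN.
    exact: le_lt_trans (coord_le_enorm x j) xe.
  (* A ball around an interior point gives one around 0: [x] is the midpoint of v + x and of the
     opposite of v - x, both in the symmetric convex set. *)
  exists e => // x xe; have := cvxC (coords v + x) (- (coords v - x)) 2^-1.
  rewrite (_ : 2^-1 *: (coords v + x) + _ = x); last first.
    by apply/rowP => i; rewrite !mxE; field.
  apply; first exact: ballC.
    by apply: symC; apply: ballC; rewrite seminormN //; exact: seminorm_enorm.
  by apply/andP; split; lra.
have clC : closed C by apply: compact_closed cC; exact: norm_hausdorff.
exists (gauge C), c; split => //.
- exact: seminorm_gauge cvxC symC d0 dC.
- exact: enorm_le_gauge d0 dC c0 Cc.
- by move=> x; exact: (gauge_le1 cvxC clC d0 dC x).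
Qed.

(** Factoring the Gram matrix of the inner product as [T *m T^T] exhibits the ellipsoid as a linear
    preimage of the Euclidean ball. *)
Lemma ellipsoid_norm (B : set V) : ellipsoid B ->
  exists2 T : 'M[R]_n, T \in unitmx &
    forall x, B (combine V x) <-> enorm (x *m T) <= 1.
Proof.
move=> [f ->]; pose G : 'M[R]_n := \matrix_(i, j) f (std_basis V i) (std_basis V j).
have fG (x y : 'rV[R]_n) : f (combine V x) (combine V y) = dot (x *m G) y.
  rewrite dotE [combine V y]/combine linear_sum; apply: eq_bigr => j _.
  rewrite linearZ /= mxE mulrC; congr (_ * _); rewrite /combine linear_sumlz.
  by apply: eq_bigr => i _; rewrite linearZl_LR /= mxE.
have posf v : v != 0 -> 0 < f v v by exact: neq0_dnorm_gt0.
have pos (x : 'rV[R]_n) : x != 0 -> 0 < dot (x *m G) x.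
  move=> x0; rewrite -fG; apply: posf; apply: contra_neq x0; exact: combine_eq0.
have [|T GT] := cholesky _ pos.
  by apply/matrixP => i j; rewrite !mxE hermC /= expr0 mul1r.
exists T => [|x].
  rewrite -row_free_unit; apply: inj_row_free => x xT; apply/eqP/negPn/negP => /pos.
  by rewrite GT mulmxA xT mul0mx dot0l ltxx.
by rewrite /= fG GT mulmxA dot_mulmxl trmxK -sqr_enorm expr_le1 ?enorm_ge0.
Qed.

End coordinates.

(** * The volume of the Euclidean ball is positive and finite *)

Section euclidean_ball.
Context (R : realType) (n : nat).

(** The ball lies between the cubes of half-side 1 / (n + 1) and 1. *)
Lemma vball_enorm : exists2 r, 0 < r & vball (@enorm R n) = r%:E.
Proof.
have sE := @seminorm_enorm R n.
pose s : R := n.+1%:R^-1; have s0 : 0 < s by rewrite invr_gt0.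
have vlt : (vball (@enorm R n) < +oo)%E.
  apply: (@le_lt_trans _ _ (leb (@cube R n))); last by rewrite leb_cube ltry.
  apply: le_leb; [exact: measurable_seminorm_le | exact: measurable_rV_cube |].
  by move=> x /= x1 i; rewrite -ler_norml (le_trans (coord_le_enorm x i)).
have vgt : (0 < vball (@enorm R n))%E.
  apply: (@lt_le_trans _ _ (leb [set x : 'rV[R]_n | forall i, - s <= x 0 i <= s])).
    by rewrite leb_box ?(ltW s0) // lte_fin exprn_gt0 // mulr_gt0.
  apply: le_leb; [exact: measurable_rV_box | exact: measurable_seminorm_le |].
  move=> x /= xs; rewrite -(expr_le1 (n := 2)) ?enorm_ge0 // sqr_enorm dotE.
  apply: (@le_trans _ _ (\sum_(i < n) s)).
    apply: ler_sum => i _; rewrite -expr2 -real_normK ?num_real //.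
    have xi : `|x 0 i| <= s by rewrite ler_norml.
    have s1 : s <= 1 by rewrite invf_le1 // ler1n.
    by have := normr_ge0 (x 0 i); nra.
  by rewrite sumr_const card_ord -mulr_natl ler_pdivrMr // mul1r ler_nat.
have vfin : vball (@enorm R n) \is a fin_num by rewrite ge0_fin_numE // ltW.
by exists (fine (vball (@enorm R n))); rewrite ?fineK // fine_gt0 // vgt vlt.
Qed.

End euclidean_ball.

Theorem corollary2 (R : realType) (n : nat) (hn : (4 <= n)%N)
    (V : vectType R) (dimV : \dim {:V} = n)
    (w : ('I_n -> V) -> R) (hw : volume_form w)
    (K : set V) (hK : convex_body K) (symK : symmetric_set K)
    (B : set V) (hB : ellipsoid B) :
  (((ln n%:R / ln 2%:R) ^- n)%:E <=
   (vol w K * vol (dual_form w) (polar K)) /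
   (vol w B * vol (dual_form w) (polar B)))%E.
Proof.
subst n; have [p [c [sp c0 cp Kp]]] := convex_body_norm hK symK.
have [T uT BT] := ellipsoid_norm hB.
set m := \dim {:V}.
have sE := @seminorm_enorm R m.
have [M M0 TM] := seminorm_le_enorm (seminorm_mulmx (invmx T) sE).
have cT x : enorm x <= M * enorm (x *m T) by rewrite (le_trans _ (TM _)) // mulmxK.
rewrite (volume_product hw sp c0 cp Kp).
rewrite (volume_product hw (seminorm_mulmx T sE) M0 cT BT).
have e1 (x : 'rV[R]_m) : enorm x <= 1 * enorm x by rewrite mul1r.
(* Linear invariance and self-duality of the Euclidean norm make the denominator the squared volume
   of the Euclidean ball, whatever the ellipsoid. *)
rewrite (vball_dual_mulmx sE ltr01 e1 uT) dual_norm_enorm.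
have := norm_volume hn sp c0 cp; have [r r0 ->] := vball_enorm R m.
have rr0 : 0 < r * r by rewrite mulr_gt0.
by rewrite -EFinM inver gt_eqF // lee_pdivlMr.
Qed.
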